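(* Let $m>1$, let $a>0$, let $(V_\delta,R_\delta,\sigma_\delta)_{0<\delta<1}$ be the family of solitary waves described in the context, and for $0<\delta<1$ let $L_\delta$ be the linearised travelling wave operator on $L^2_a$ with domain $H^1_a$, $$L_\delta\begin{pmatrix}S\\ W\end{pmatrix}=\begin{pmatrix}\frac{d}{dx}S-\nabla^{\pm}_{1/2}W\\[2pt] \frac{d}{dx}W-\frac{1}{\sigma_\delta}\nabla^{\pm}_{1/2}\bigl(\Phi''(R_\delta)\,S\bigr)\end{pmatrix}.$$ Then there exists $\delta_0>0$ such that $$\ker L_\delta=\operatorname{span}\left\{\left(\frac{dR_\delta}{dx},\frac{dV_\delta}{dx}\right)\right\}$$ holds for all $0<\delta<\delta_0$.
   Context: Fix $m\in\mathbb{R}$ with $m>1$ and the potential $$\Phi(r)=\frac{1}{m(m+1)}\left(\frac{1}{(1-r)^m}-m\,r-1\right),\qquad r<1.$$ A solution of the travelling wave equations with parameter $\sigma>0$ is a pair of continuously differentiable functions $R,V:\mathbb{R}\to\mathbb{R}$ with $R(x)<1$ for all $x$ such that, for all $x\in\mathbb{R}$, $R'(x)=V(x+\frac12)-V(x-\frac12)$ and $\sigma V'(x)=\Phi'(R(x+\frac12))-\Phi'(R(x-\frac12))$. A function is called unimodal if it is increasing for $x<0$ and decreasing for $x>0$. Family of solitary waves: $(V_\delta,R_\delta,\sigma_\delta)_{0<\delta<1}$ is a fixed family such that, for each $\delta\in(0,1)$, $\sigma_\delta>0$ and $(R_\delta,V_\delta)$ solves the travelling wave equations with parameter $\sigma_\delta$,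 and moreover: (1) $V_\delta$ and $R_\delta$ belong to $L^2(\mathbb{R})\cap BC^1(\mathbb{R})$ (where $BC^1(\mathbb{R})$ denotes the $C^1$ functions that are bounded together with their derivative) and are nonnegative, even and unimodal; (2) $\|V_\delta\|_{L^2}=1-\delta$ and $R_\delta$ takes values in $[0,1)$; (3) $\int_{\mathbb{R}}\Phi(R_\delta(x))\,dx\to\infty$ as $\delta\to0$. (The existence of such a family is known.) Notation: $(\nabla^{\pm}_{1/2}F)(x)=F(x+\frac12)-F(x-\frac12)$. For $a\in\mathbb{R}$, $$L^2_a=\{(S,W):\mathbb{R}\to\mathbb{R}^2:\ e^{ax}(S(x),W(x))\in L^2(\mathbb{R},\mathbb{R}^2)\},\qquad H^1_a=\{(S,W):\mathbb{R}\to\mathbb{R}^2:\ e^{ax}(S(x),W(x))\in H^1(\mathbb{R},\mathbb{R}^2)\}.$$ *)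

(* Defs.v *)
From HB Require Import structures.
From mathcomp Require Import all_boot all_order all_algebra.
From mathcomp Require Import all_classical all_reals all_analysis.

Set Implicit Arguments.
Unset Strict Implicit.
Unset Printing Implicit Defensive.

Import Order.TTheory GRing.Theory Num.Theory.
Import numFieldNormedType.Exports.

Local Open Scope classical_set_scope.
Local Open Scope ring_scope.

Definition nabla (R : realType) (F : R -> R) (x : R) : R :=
  F (x + 2^-1) - F (x - 2^-1).

(* Only the values at r < 1 matter: on that open half-line the base 1 - r of
   the real power is positive, and Phi', Phi'' are the derivatives of Phi
   itself. *)
Definition Phi (R : realType) (m r : R) : R :=
  (m * (m + 1))^-1 * (((1 - r) `^ m)^-1 - m * r - 1).

Definition C1 (R : realType) (f : R -> R) : Prop :=
  (forall x, derivable f x 1) /\ continuous (f^`())%classic.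

Definition BC1 (R : realType) (f : R -> R) : Prop :=
  [/\ C1 f, bounded_fun f & bounded_fun (f^`())%classic].

Definition L2 (R : realType) (f : R -> R) : Prop :=
  f \in Lfun (@lebesgue_measure R) 2%:E.

Definition even_fun (R : realType) (f : R -> R) : Prop :=
  forall x, f (- x) = f x.

(* Monotonicity is meant in the wide sense. *)
Definition unimodal (R : realType) (f : R -> R) : Prop :=
  (forall x y, x <= y -> y < 0 -> f x <= f y) /\
  (forall x y, 0 < x -> x <= y -> f y <= f x).

Definition travelling_wave (R : realType) (m sigma : R) (r v : R -> R) : Prop :=
  [/\ C1 r, C1 v, (forall x, r x < 1),
      (forall x, (r^`())%classic x = nabla v x) &
      (forall x, sigma * (v^`())%classic x =
                 nabla (((Phi m)^`())%classic \o r) x)].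

(* The families are indexed by all reals, but only their members with index
   in ]0, 1[ are constrained. *)
Definition solitary_family (R : realType) (m : R)
    (V Rd : R -> R -> R) (sigma : R -> R) : Prop :=
  (forall d, 0 < d < 1 ->
    [/\ 0 < sigma d /\ travelling_wave m (sigma d) (Rd d) (V d),
        [/\ L2 (V d), BC1 (V d), (forall x, 0 <= V d x),
            even_fun (V d) & unimodal (V d)],
        [/\ L2 (Rd d), BC1 (Rd d), (forall x, 0 <= Rd d x),
            even_fun (Rd d) & unimodal (Rd d)],
        ('N[lebesgue_measure]_2%:E[EFin \o V d] = (1 - d)%:E)%E &
        (forall x, 0 <= Rd d x < 1)]) /\
  ((\int[lebesgue_measure]_x (Phi m (Rd d x))%:E)%E @[d --> 0^'+] --> +oo%E).

Definition test_function (R : realType) (phi : R -> R) : Prop :=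
  (forall (n : nat) (x : R), derivable (phi^`(n))%classic x 1) /\
  compact (closure [set x | phi x != 0]).

Definition weak_derivative (R : realType) (f g : R -> R) : Prop :=
  [/\ locally_integrable [set: R] f, locally_integrable [set: R] g &
      forall phi, test_function phi ->
        (\int[lebesgue_measure]_x (f x * (phi^`())%classic x)%:E =
         - \int[lebesgue_measure]_x (g x * phi x)%:E)%E].

Definition H1 (R : realType) (f : R -> R) : Prop :=
  L2 f /\ exists2 g, L2 g & weak_derivative f g.

Definition weighted (R : realType) (a : R) (f : R -> R) : R -> R :=
  fun x => expR (a * x) * f x.

(* Elements of L^2_a and H^1_a are represented by pairs of (Borel) measurable
   functions; two pairs stand for the same element iff they agree a.e. *)
Definition L2w (R : realType) (a : R) : set ((R -> R) * (R -> R)) :=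
  [set u | L2 (weighted a u.1) /\ L2 (weighted a u.2)].

Definition H1w (R : realType) (a : R) : set ((R -> R) * (R -> R)) :=
  [set u | H1 (weighted a u.1) /\ H1 (weighted a u.2)].

(* The graph of the unbounded operator L on L^2_a with domain H^1_a, for the
   profile r and the parameter sigma: L u = w.  Both d/dx are weak. *)
Definition linop (R : realType) (m a sigma : R) (r : R -> R)
    (u w : (R -> R) * (R -> R)) : Prop :=
  [/\ H1w a u, L2w a w &
      exists dS dW : R -> R,
        [/\ weak_derivative u.1 dS, weak_derivative u.2 dW,
            w.1 = (fun x => dS x - nabla u.2 x) %[ae lebesgue_measure] &
            w.2 = (fun x => dW x - sigma^-1 *
                     nabla (fun y => ((Phi m)^`(2))%classic (r y) * u.1 y) x)
              %[ae lebesgue_measure]]].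

Definition ker_linop (R : realType) (m a sigma : R) (r : R -> R) :
    set ((R -> R) * (R -> R)) :=
  [set u | linop m a sigma r u (cst 0, cst 0)].

(* All measurable representatives of the elements of span {v}.  Membership of
   v in L^2_a is deliberately not imposed here, so that an equality
   "kernel = span" does assert that v lies in the kernel. *)
Definition span1 (R : realType) (v : (R -> R) * (R -> R)) :
    set ((R -> R) * (R -> R)) :=
  [set u | [/\ measurable_fun [set: R] u.1, measurable_fun [set: R] u.2 &
     exists c : R,
       u.1 = (fun x => c * v.1 x) %[ae lebesgue_measure] /\
       u.2 = (fun x => c * v.2 x) %[ae lebesgue_measure]]].

(* Main.v *)
Require Import Defs.
From HB Require Import structures.
From mathcomp Require Import all_boot all_order all_algebra.
From mathcomp Require Import all_classical all_reals all_analysis.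
From mathcomp Require Import measurable_realfun ring lra.
Import Order.TTheory GRing.Theory Num.Theory.
Import numFieldNormedType.Exports.
Local Open Scope classical_set_scope.
Local Open Scope ring_scope.

(** Let A f (x) be the integral of f over the interval of length one centred at x
    and put p = Phi''(R) / sigma.  The weight makes an element (S, W) of the kernel
    decay at +oo, and integrating its two equations from there gives S = A W and
    W = A (p S) ([weak_avg]).  Since the square of A is the convolution with the
    tent function L(t) = max(0, 1 - |t|) ([avg_avg_cc]), this means
      S = L * (p S).
    In the same way the wave satisfies R = L * (Phi'(R) / sigma) and therefore
    R' = L * (p R').  The claim is that the only solutions S are the multiples of
    R'.

    Decay.  At -oo the weight permits S to grow like exp (a |x|).  The identities
    R = A V and sigma V = A (Phi'(R)) imply that sigma times the squared norm of V
    is the integral of R Phi'(R), which by convexity is at least the integral of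
    Phi(R) ([energy_le]).  Hence sigma tends to infinity as delta tends to 0, and
    for small delta the coefficient p is far out so small, compared with the weight,
    that the values of S contract at every unit step towards -oo ([tail_decay]).
    So S is summable, and so are R and R', which even decay fast enough for (R', V')
    to belong to the weighted space.  This is the only place where delta has to be
    small.

    Uniqueness.  The reflected function S(-x) solves the same equation, so even and
    odd solutions can be treated separately, on the half-line and with the kernels
    L(x - y) + L(x + y) and L(x - y) - L(x + y).

    The odd kernel is nonnegative and R' has a sign on the half-line, so R' is a
    ground state of a symmetric positive operator: by pairing with p R', every
    nonnegative subsolution is a solution ([odd_subsolution_eq]), and a solution
    with a zero vanishes identically ([odd_solution_positivity]).  Hence every odd
    solution is a multiple of R'.

    For an even solution S the decisive fact is
      0 <= L(x - y) + L(x + y) - 2 L(x) L(y) <= L(x - y) - L(x + y)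
    for x, y >= 0 ([tentD_le], [tent_mul_le]).  The subtracted rank-one kernel,
    applied to p S, is S(0) L(x).  If S(0) >= 0, which may be assumed, the negative
    part of S is thus a subsolution of the odd problem, hence a solution, and then
    it vanishes because the second inequality is strict near (1/2, 1/2); so S >= 0
    ([even_solution_ge0]).  Pairing S with R shows that
    S (p R - Phi'(R) / sigma) has integral zero, and as Phi'(R) < R Phi''(R) this is
    only possible if S = 0 ([nonneg_solution_zero]). *)

Set Implicit Arguments.
Unset Strict Implicit.
Unset Printing Implicit Defensive.

(** * Translations and reflections preserve Lebesgue measure *)

Section invariance.
Context {R : realType}.
Local Notation mu := (@lebesgue_measure R).

Definition preserves (G : R -> R) :=
  measurable_fun [set: R] G /\
  forall A : set R, measurable A -> mu (G @^-1` A) = mu A.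

(** Lebesgue measure is determined by its values on half-open intervals. *)
Lemma preserves_itv (G : R -> R) : measurable_fun [set: R] G ->
  (forall a b : R, a <= b -> mu (G @^-1` `]a, b]) = (b - a)%:E) -> preserves G.
Proof.
move=> mG Gab; split=> // A mA.
have HG : isMeasurableFun _ _ (measurableTypeR R) (measurableTypeR R) G.
  by constructor.
pose G' : {mfun measurableTypeR R >-> measurableTypeR R} := HB.pack G HG.
apply/esym/(@lebesgue_measure_unique R (pushforward mu G')) => //.
move=> _ [[a b]] /= _ <-; rewrite /pushforward /=.
have [ab|ba] := leP a b.
  rewrite Gab// lebesgue_measure_itv/= lte_fin.
  by case: ltgtP ab => //= -> _; rewrite subrr.
by rewrite set_itv_ge ?preimage_set0 ?measure0// bnd_simp -leNgt ltW.
Qed.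

Lemma preserves_shift (c : R) : preserves (fun x => x + c).
Proof.
apply: preserves_itv => [|a b ab]; first exact: measurable_funD.
rewrite (_ : _ @^-1` _ = `]a - c, b - c]%classic).
  rewrite lebesgue_measure_itv/= lte_fin.
  case: ltgtP => [_|h|h] /=; first by congr EFin; lra.
    by exfalso; lra.
  by congr EFin; lra.
by apply/seteqP; split => x /=; rewrite !in_itv/= => /andP[h1 h2]; apply/andP; split; lra.
Qed.

Lemma preserves_opp : preserves (fun x => - x).
Proof.
apply: preserves_itv => [|a b ab]; first exact: measurableT_comp.
rewrite (_ : _ @^-1` _ = `[- b, - a[%classic).
  rewrite lebesgue_measure_itv/= lte_fin.
  case: ltgtP => [_|h|h] /=; first by congr EFin; lra.
    by exfalso; lra.
  by congr EFin; lra.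
by apply/seteqP; split => x /=; rewrite !in_itv/= => /andP[h1 h2]; apply/andP; split; lra.
Qed.

Lemma preserves_ge0_integral (G : R -> R) (f : R -> \bar R) : preserves G ->
  measurable_fun [set: R] f -> (forall x, 0 <= f x)%E ->
  (\int[mu]_x f (G x) = \int[mu]_x f x)%E.
Proof.
move=> [mG pG] mf f0.
have := @ge0_integral_pushforward _ _ (measurableTypeR R) (measurableTypeR R) R G mG mu setT f measurableT mf.
rewrite preimage_setT => <- //.
by apply: eq_measure_integral => A mA _; apply: pG.
Qed.

Lemma preserves_integral (G : R -> R) (f : R -> \bar R) : preserves G ->
  measurable_fun [set: R] f ->
  (\int[mu]_x f (G x) = \int[mu]_x f x)%E.
Proof.
move=> pG mf; rewrite integralE [RHS]integralE; congr (_ - _)%E.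
  rewrite -(@preserves_ge0_integral _ (f^\+)%E pG) //.
    by apply: eq_integral => x _; rewrite !funeposE.
  exact: measurable_funepos.
rewrite -(@preserves_ge0_integral _ (f^\-)%E pG) //.
  by apply: eq_integral => x _; rewrite !funenegE.
exact: measurable_funeneg.
Qed.

Lemma preserves_Rintegral (G f : R -> R) : preserves G ->
  measurable_fun [set: R] f ->
  \int[mu]_x f (G x) = \int[mu]_x f x.
Proof.
move=> pG mf; rewrite /Rintegral (@preserves_integral _ (EFin \o f) pG)//.
exact/measurable_EFinP.
Qed.

Lemma preserves_integrable (G f : R -> R) : preserves G ->
  mu.-integrable [set: R] (EFin \o f) ->
  mu.-integrable [set: R] (EFin \o (f \o G)).
Proof.
move=> pG /integrableP[mf foo]; have [mG _] := pG.
have mf' : measurable_fun [set: R] f by exact/measurable_EFinP.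
apply/integrableP; split.
  by apply/measurable_EFinP; exact: measurableT_comp.
rewrite /= (@preserves_ge0_integral _ (fun x => `|(f x)%:E|%E) pG)//.
exact: measurableT_comp.
Qed.

Lemma preserves_ae (G : R -> R) (P : R -> Prop) : preserves G ->
  {ae mu, forall x, P x} -> {ae mu, forall x, P (G x)}.
Proof.
move=> [mG pG] [N [mN N0 sN]]; exists (G @^-1` N); split.
- by rewrite -[X in measurable X]setTI; exact: mG.
- by rewrite pG.
- by move=> x nP; apply: sN.
Qed.

End invariance.

(** * Primitives and sliding averages *)

Section calculus.
Context {R : realType}.
Implicit Types (f h H : R -> R) (a b x y c : R).
Local Notation mu := (@lebesgue_measure R).

Definition primitive h H := forall x, is_derive x 1 H (h x).

Lemma is_derive_continuous f df : primitive df f -> continuous f.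
Proof.
move=> d x; apply: differentiable_continuous; apply/derivable1_diffP.
by case: (d x).
Qed.

Lemma continuous_integrable_cc h a b : continuous h ->
  mu.-integrable `[a, b] (EFin \o h).
Proof.
move=> ch; apply: continuous_compact_integrable; first exact: segment_compact.
exact: continuous_subspaceT.
Qed.

Lemma Rintegral_cc_split h a b c : continuous h -> a <= b -> b <= c ->
  \int[mu]_(y in `[a, c]) h y =
  \int[mu]_(y in `[a, b]) h y + \int[mu]_(y in `[b, c]) h y.
Proof.
move=> ch ab bc.
have /= := @Rintegral_itvB R h (BLeft a) (BRight c) b
  (continuous_integrable_cc a c ch).
rewrite !bnd_simp => /(_ ab bc).
rewrite Rintegral_itv_obnd_cbnd; first by move=> <-; rewrite addrC subrK.
apply: integrableS (continuous_integrable_cc a c ch) => //.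
by apply: subset_itvr; rewrite bnd_simp.
Qed.

Lemma primitive_Rintegral h H a b : continuous h -> primitive h H -> a <= b ->
  \int[mu]_(y in `[a, b]) h y = H b - H a.
Proof.
move=> ch dH; rewrite le_eqVlt => /predU1P[<-|ab].
  by rewrite set_itv1 Rintegral_set1 subrr.
have cH := is_derive_continuous dH.
rewrite /Rintegral (@continuous_FTC2 R h H a b ab).
- by rewrite -EFinB.
- exact: continuous_subspaceT.
- split.
  + by move=> x _; case: (dH x).
  + by apply: cvg_at_right_filter; exact: cH.
  + by apply: cvg_at_left_filter; exact: cH.
- by move=> x _; rewrite derive1E; case: (dH x).
Qed.

(** Near x the primitive is an integral from a base point N far to the left of
    both 0 and x, up to a constant; no distinction of signs is then needed. *)
Lemma primitive_ex h : continuous h -> exists H, primitive h H.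
Proof.
move=> ch.
pose F a x := \int[mu]_(y in `[a, x]) h y.
pose H x := F (- `|x| - 1) x - F (- `|x| - 1) 0.
exists H => x.
(* N is to the left of the base point - |y| - 1 of every y with |y - x| < 1. *)
pose N := - `|x| - 3.
have FE y : `|y - x| < 1 -> H y = F N y - F N 0.
  move=> yx; rewrite /H.
  have yx' : `|y| <= `|x| + 1.
    rewrite -[y](subrK x) (le_trans (ler_normD _ _))// addrC lerD2l; exact: ltW.
  have y0 := normr_ge0 y.
  rewrite /F (@Rintegral_cc_split h N (- `|y| - 1) y)//; last 2 first.
    by rewrite /N; lra.
    have := ler_norm (- y); rewrite normrN; lra.
  rewrite (@Rintegral_cc_split h N (- `|y| - 1) 0)//; last by rewrite /N; lra.
  by rewrite opprD addrACA subrr add0r.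
have Nx : N < x by rewrite /N; have := ler_norm (- x); rewrite normrN; lra.
have [dF F'] := @continuous_FTC1_closed R h N x (x + 1)
  (ltac:(by rewrite ltrDl)) (continuous_integrable_cc _ _ ch) Nx (ch x).
have iF : is_derive x 1 (fun y => F N y - F N 0) (h x).
  rewrite -[h x]subr0; apply: is_deriveB.
  by split; [exact: dF|rewrite -derive1E F'].
apply: near_eq_is_derive iF.
near=> y; rewrite FE//.
Unshelve. all: by end_near. Qed.

(** Convolution with the indicator function of the interval of length one
    centred at 0. *)
Definition avg h x := \int[mu]_(y in `[x - 2^-1, x + 2^-1]) h y.

Lemma primitive_avg h H x : continuous h -> primitive h H ->
  avg h x = H (x + 2^-1) - H (x - 2^-1).
Proof. by move=> ch dH; rewrite /avg (primitive_Rintegral ch dH)//; lra. Qed.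

(** This turns every pointwise bound on h into a bound on its averages. *)
Lemma avg_mean h x : continuous h ->
  exists2 c, `|c - x| < 2^-1 & avg h x = h c.
Proof.
move=> ch; have [H dH] := primitive_ex ch.
have [|||c] := @MVT R H h (x - 2^-1) (x + 2^-1).
- by lra.
- by move=> y _; exact: dH.
- exact/continuous_subspaceT/(is_derive_continuous dH).
rewrite in_itv/= => /andP[c1 c2] E.
exists c; first by rewrite ltr_norml; apply/andP; split; lra.
by rewrite (primitive_avg _ ch dH) E; lra.
Qed.

Lemma is_derive_shiftc f (c x l : R) : is_derive (x + c) 1 f l ->
  is_derive x 1 (fun y => f (y + c)) l.
Proof.
move=> d.
have dg : is_derive x 1 (fun y : R => y + c) 1.
  by rewrite -[X in is_derive _ _ _ X]addr0; apply: is_deriveD.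
by have := @is_derive1_comp R f (fun y => y + c) x l 1 d dg; rewrite mulr1.
Qed.

(** Averages invert the difference operator up to d/dx: an unknown whose
    derivative is [nabla h] and which vanishes at infinity has to be [avg h]. *)
Lemma avg_derive h : continuous h -> primitive (nabla h) (avg h).
Proof.
move=> ch x; have [H dH] := primitive_ex ch.
have -> : avg h = (fun y => H (y + 2^-1) - H (y - 2^-1)).
  by apply/funext => y; exact: primitive_avg.
by apply: is_deriveB; apply: is_derive_shiftc; exact: dH.
Qed.

Lemma avg_continuous h : continuous h -> continuous (avg h).
Proof. by move=> /avg_derive/is_derive_continuous. Qed.

Lemma primitive_cst f : primitive (fun=> 0) f -> forall x y, f x = f y.
Proof.
move=> df.
by move=> x y; apply: is_derive_0_is_cst => z; exact: df.
Qed.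

Lemma primitive_unique f h H : primitive h H -> primitive h f ->
  exists c, forall x, f x = H x + c.
Proof.
move=> dH df; exists (f 0 - H 0) => x.
have d0 : primitive (fun=> 0) (fun x => f x - H x).
  by move=> y; rewrite -(subrr (h y)); exact: is_deriveB.
by have := primitive_cst d0 x 0; lra.
Qed.

End calculus.

(** * The tent function *)

Section tent.
Context {R : realType}.
Implicit Types (f h H : R -> R) (a b x y c t : R).
Local Notation mu := (@lebesgue_measure R).

Definition tent t : R := Num.max 0 (1 - `|t|).

Lemma tent_ge0 t : 0 <= tent t.
Proof. by rewrite le_max lexx. Qed.

Lemma tent_le1 t : tent t <= 1.
Proof. by rewrite ge_max ler01/=; have := normr_ge0 t; lra. Qed.

Lemma tentN t : tent (- t) = tent t.
Proof. by rewrite /tent normrN. Qed.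

Lemma tent_norm t : tent `|t| = tent t.
Proof. by rewrite /tent normr_id. Qed.

Lemma tent_in t : `|t| <= 1 -> tent t = 1 - `|t|.
Proof. by move=> t1; rewrite /tent; apply/max_idPr; rewrite subr_ge0. Qed.

Lemma tent_out t : 1 <= `|t| -> tent t = 0.
Proof. by move=> t1; rewrite /tent; apply/max_idPl; rewrite subr_le0. Qed.

Lemma tent_lipschitz s t : `|tent s - tent t| <= `|s - t|.
Proof.
have st : `| `|s| - `|t| | <= `|s - t| := ler_dist_dist s t.
apply: le_trans st; rewrite /tent.
by case: (lerP 0 (1 - `|s|)) => h1; case: (lerP 0 (1 - `|t|)) => h2;
   case: (ger0P (`|s| - `|t|)) => h3;
   rewrite ler_norml; apply/andP; split; lra.
Qed.

Lemma tent_continuous : continuous tent.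
Proof.
move=> x; apply/cvgrPdist_lt => e e0; near=> t.
rewrite (le_lt_trans (tent_lipschitz _ _))//.
Unshelve. all: by end_near. Qed.

(** The unit window convolved with itself is the tent.  On each half of
    [x - 1, x + 1] the tent is affine, so that two integrations by parts turn the
    right-hand side into the second difference of a second primitive of h, and
    the left-hand side is the same second difference. *)
Lemma avg_avg_cc h x : continuous h ->
  avg (avg h) x = \int[mu]_(y in `[x - 1, x + 1]) (tent (x - y) * h y).
Proof.
move=> ch.
have [H1 dH1] := primitive_ex ch.
have cH1 := is_derive_continuous dH1.
have [H2 dH2] := primitive_ex cH1.
have cH2 := is_derive_continuous dH2.
have avgE : avg h = (fun y => H1 (y + 2^-1) - H1 (y - 2^-1)).
  by apply/funext => y; exact: primitive_avg.
have dA : primitive (avg h) (fun y => H2 (y + 2^-1) - H2 (y - 2^-1)).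
  by move=> y; rewrite avgE; apply: is_deriveB; apply: is_derive_shiftc;
     exact: dH2.
rewrite (primitive_avg _ (avg_continuous ch) dA).
have ct : continuous (fun y => tent (x - y) * h y).
  move=> y; apply: cvgM; last exact: ch.
  apply: (@continuous_comp _ _ _ (fun y => x - y) tent).
    by apply: cvgB; [exact: cvg_cst|exact: cvg_id].
  exact: tent_continuous.
rewrite (@Rintegral_cc_split _ _ (x - 1) x)//; [|by lra|by lra].
have dl (s : R) : primitive (fun y => (1 + s * (x - y)) * h y)
    (fun y => (1 + s * (x - y)) * H1 y + s * H2 y).
  move=> y.
  have d1 : is_derive y 1 (fun y => 1 + s * (x - y)) (- s).
    apply: is_derive_eq => /=.
    by rewrite /GRing.scale/=; ring.
  have d2 := dH1 y. have d3 := dH2 y.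
  apply: is_derive_eq.
  by rewrite /GRing.scale/=; ring.
have cl (s : R) : continuous (fun y => (1 + s * (x - y)) * h y).
  move=> y; apply: cvgM; last exact: ch.
  by apply: cvgD; [exact: cvg_cst|apply: cvgM; [exact: cvg_cst|
    apply: cvgB; [exact: cvg_cst|exact: cvg_id]]].
have -> : \int[mu]_(y in `[x - 1, x]) (tent (x - y) * h y) =
          \int[mu]_(y in `[x - 1, x]) ((1 + (-1) * (x - y)) * h y).
  apply: eq_Rintegral => y; rewrite inE/= in_itv/= => /andP[y1 y2].
  rewrite tent_in ger0_norm; by [congr (_ * _); lra|lra].
have -> : \int[mu]_(y in `[x, x + 1]) (tent (x - y) * h y) =
          \int[mu]_(y in `[x, x + 1]) ((1 + 1 * (x - y)) * h y).
  apply: eq_Rintegral => y; rewrite inE/= in_itv/= => /andP[y1 y2].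
  rewrite tent_in ler0_norm; by [congr (_ * _); lra|lra].
rewrite (primitive_Rintegral (cl _) (dl _)); last by lra.
rewrite (primitive_Rintegral (cl _) (dl _)); last by lra.
have -> : x + 2^-1 + 2^-1 = x + 1 by lra.
have -> : x + 2^-1 - 2^-1 = x by lra.
have -> : x - 2^-1 + 2^-1 = x by lra.
have -> : x - 2^-1 - 2^-1 = x - 1 by lra.
ring.
Qed.

Lemma avg_avg_tent_conv h x : continuous h ->
  avg (avg h) x = \int[mu]_y (tent (x - y) * h y).
Proof.
move=> ch; rewrite avg_avg_cc// Rintegral_mkcond; apply: eq_Rintegral => y _.
rewrite patchE; case: ifPn => //.
rewrite notin_setE/= in_itv/= => yx.
rewrite tent_out ?mul0r// leNgt; apply/negP => /ltr_normlP[h1 h2].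
by apply: yx; apply/andP; split; lra.
Qed.

End tent.

(** * Summable functions *)

Section summable.
Context {R : realType}.
Implicit Types (f g h H : R -> R) (a b x y c t : R).
Local Notation mu := (@lebesgue_measure R).

Definition L1 f := mu.-integrable [set: R] (EFin \o f).

Lemma continuous_meas f : continuous f -> measurable_fun [set: R] f.
Proof. exact: continuous_measurable_fun. Qed.

Lemma L1_meas f : L1 f -> measurable_fun [set: R] f.
Proof. by move=> /integrableP[/measurable_EFinP]. Qed.

Lemma L1_le f g : measurable_fun [set: R] f -> L1 g ->
  (forall x, `|f x| <= `|g x|) -> L1 f.
Proof.
move=> mf ig fg; apply: (@le_integrable _ _ _ mu setT _ (EFin \o f) (EFin \o g)) => //.
  exact/measurable_EFinP.
by move=> x _; rewrite /= lee_fin.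
Qed.

Lemma L1Z c f : L1 f -> L1 (fun x => c * f x).
Proof.
move=> intf; have := @integrableZl _ _ _ mu setT measurableT c _ intf.
by apply: eq_integrable.
Qed.

Lemma L1D f g : L1 f -> L1 g -> L1 (fun x => f x + g x).
Proof.
move=> intf ig; have := integrableD measurableT intf ig.
by apply: eq_integrable.
Qed.

Lemma L1B f g : L1 f -> L1 g -> L1 (fun x => f x - g x).
Proof.
move=> intf ig; have := integrableB measurableT intf ig.
by apply: eq_integrable.
Qed.

Lemma L1M M g f : measurable_fun [set: R] g -> (forall x, `|g x| <= M) ->
  L1 f -> L1 (fun x => g x * f x).
Proof.
move=> mg gM intf; apply: (@L1_le _ (fun x => M * f x)).
- by apply: measurable_funM => //; exact: L1_meas.
- exact: L1Z.
- move=> x; rewrite !normrM ler_wpM2r//.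
  by apply: le_trans (gM x) _; exact: ler_norm.
Qed.

Lemma L1_norm f : L1 f -> L1 (fun x => `|f x|).
Proof.
move=> intf; apply: (@L1_le _ f) => //; last by move=> x; rewrite normr_id.
by apply: measurableT_comp => //; exact: L1_meas.
Qed.

Lemma L1_bounded M g f : continuous g -> (forall x, `|g x| <= M) ->
  L1 f -> L1 (fun x => g x * f x).
Proof. by move=> cg; apply: L1M; exact: continuous_meas. Qed.

Lemma Rintegral_EFin f : L1 f -> (\int[mu]_x (f x)%:E)%E = (\int[mu]_x f x)%:E.
Proof. by move=> intf; rewrite fineK//; exact: integrable_fin_num. Qed.

Lemma L1_le_Rintegral f g : L1 f -> L1 g -> (forall x, f x <= g x) ->
  \int[mu]_x f x <= \int[mu]_x g x.
Proof. by move=> intf ig fg; apply: le_Rintegral => // x _; exact: fg. Qed.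

Lemma Rintegral_cc_le f a b : continuous f -> (forall x, 0 <= f x) -> L1 f ->
  \int[mu]_(x in `[a, b]) f x <= \int[mu]_x f x.
Proof.
move=> cf f0 intf; rewrite Rintegral_mkcond.
apply: L1_le_Rintegral => // [|y]; last by rewrite patchE; case: ifPn.
have := continuous_integrable_cc a b cf.
by move=> /integrable_mkcond-/(_ (measurable_itv _)); rewrite restrict_EFin.
Qed.

(** A primitive of f increases on an interval by at most the integral of f over
    the line, so it is constant. *)
Lemma Rintegral_eq0 f : continuous f -> (forall x, 0 <= f x) -> L1 f ->
  \int[mu]_x f x = 0 -> forall x, f x = 0.
Proof.
move=> cf f0 intf If x.
have [F dF] := primitive_ex cf.
have Fcst a b : a <= b -> F b = F a.
  move=> ab; apply/eqP; rewrite -subr_eq0 eq_le.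
  rewrite -(primitive_Rintegral cf dF ab).
  by rewrite [X in _ && X]Rintegral_ge0// andbT -If Rintegral_cc_le.
have d0 : is_derive x 1 F 0.
  have -> : F = cst (F 0).
    by apply/funext => y /=; case: (leP y 0) => [|/ltW] /Fcst ->.
  exact: is_derive_cst.
have := dF x => /(@derive_val _ _ _ _ _ _ _) <-.
by have := d0 => /(@derive_val _ _ _ _ _ _ _) ->.
Qed.

Lemma L1_shift c f : L1 f -> L1 (fun x => f (x + c)).
Proof. exact: (preserves_integrable (preserves_shift c)). Qed.

Lemma L1_opp f : L1 f -> L1 (fun x => f (- x)).
Proof. exact: (preserves_integrable preserves_opp). Qed.

End summable.

(** * Integral operators with bounded symmetric kernels *)

Section operators.
Context {R : realType}.
Implicit Types (f g h H : R -> R) (a b x y c t : R) (k : R -> R -> R).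
Local Notation mu := (@lebesgue_measure R).

(** The Lipschitz bound makes the images of summable functions continuous and
    the uniform bound makes the integrals converge.  The constant 4 is large enough
    for all the kernels built from the tent below. *)
Record kernel k := Kernel {
  kernel_ge0 : forall x y, 0 <= k x y ;
  kernel_le4 : forall x y, k x y <= 4 ;
  kernel_sym : forall x y, k x y = k y x ;
  kernel_lip : forall x x' y, `|k x y - k x' y| <= 4 * `|x - x'| ;
  kernel_meas : measurable_fun [set: R * R] (fun z => k z.1 z.2) }.

(** The factor 1/2 is there for kernels and functions that are even in y: the
    integral over the line is then twice the integral over the half-line. *)
Definition fold_op k h x := 2^-1 * \int[mu]_y (k x y * h y).

Lemma lipschitz_continuous (M : R) f :
  (forall x y, `|f x - f y| <= M * `|x - y|) -> continuous f.
Proof.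
move=> fM x; apply/cvgrPdist_lt => e e0; near=> t.
rewrite (le_lt_trans (fM _ _))//.
rewrite (@le_lt_trans _ _ ((`|M| + 1) * `|x - t|))//.
  by rewrite ler_wpM2r//; have := ler_norm M; lra.
have M1 : 0 < `|M| + 1 by have := normr_ge0 M; lra.
rewrite mulrC -ltr_pdivlMr//.
near: t; apply: cvgr_dist_lt => //.
by rewrite divr_gt0.
Unshelve. all: by end_near. Qed.

Section kernel_theory.
Context (k : R -> R -> R) (kk : kernel k).

Lemma kernel_continuous x : continuous (k x).
Proof.
apply: (@lipschitz_continuous 4) => y y'.
by rewrite !(kernel_sym kk x); exact: kernel_lip.
Qed.

Lemma kernel_norm x y : `|k x y| <= 4.
Proof. by rewrite ger0_norm; [exact: kernel_le4|exact: kernel_ge0]. Qed.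

Lemma fold_op_integrand_L1 h x : L1 h -> L1 (fun y => k x y * h y).
Proof.
by apply: (@L1_bounded _ 4); [exact: kernel_continuous|exact: kernel_norm].
Qed.

Lemma fold_op_continuous h : L1 h -> continuous (fold_op k h).
Proof.
move=> ih; apply: (@lipschitz_continuous (2 * \int[mu]_y `|h y|)) => x x'.
rewrite /fold_op -mulrBr -RintegralB//; [|exact: fold_op_integrand_L1..].
rewrite normrM ger0_norm//.
have E : 4 * `|x - x'| * \int[mu]_y `|h y| = \int[mu]_y (4 * `|x - x'| * `|h y|).
  by rewrite RintegralZl//; exact: L1_norm.
rewrite (_ : 2 * _ * _ = 2^-1 * (4 * `|x - x'| * \int[mu]_y `|h y|)); last by lra.
rewrite E ler_wpM2l// (le_trans (le_normr_Rintegral _ _))//.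
  by apply: L1B; exact: fold_op_integrand_L1.
apply: L1_le_Rintegral.
- by apply: L1_norm; apply: L1B; exact: fold_op_integrand_L1.
- by apply: L1Z; exact: L1_norm.
- move=> y; rewrite -mulrBl normrM ler_wpM2r//; exact: kernel_lip.
Qed.

Lemma fold_op_ge0 h x : (forall y, 0 <= h y) -> 0 <= fold_op k h x.
Proof.
by move=> h0; rewrite mulr_ge0// Rintegral_ge0// => y _;
  rewrite mulr_ge0//; exact: kernel_ge0.
Qed.

Lemma fold_op_mono h h' x : L1 h -> L1 h' -> (forall y, h y <= h' y) ->
  fold_op k h x <= fold_op k h' x.
Proof.
move=> ih ih' hh'; rewrite ler_wpM2l// L1_le_Rintegral//; try exact: fold_op_integrand_L1.
by move=> y; rewrite ler_wpM2l//; exact: kernel_ge0.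
Qed.

Lemma fold_opZ h x c : L1 h -> fold_op k (fun y => c * h y) x = c * fold_op k h x.
Proof.
move=> ih; rewrite /fold_op mulrCA -(@RintegralZl _ _ _ mu setT _ c)//; last exact: fold_op_integrand_L1.
by under eq_Rintegral do rewrite mulrCA.
Qed.

Lemma fold_op_bounded h x : L1 h -> `|fold_op k h x| <= 2 * \int[mu]_y `|h y|.
Proof.
move=> ih; rewrite /fold_op normrM ger0_norm//.
rewrite (_ : 2 * _ = 2^-1 * (4 * \int[mu]_y `|h y|)); last by lra.
rewrite ler_wpM2l// (le_trans (le_normr_Rintegral _ _))//.
  exact: fold_op_integrand_L1.
rewrite -RintegralZl//; last exact: L1_norm.
apply: L1_le_Rintegral.
- by apply: L1_norm; exact: fold_op_integrand_L1.
- by apply: L1Z; exact: L1_norm.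
- by move=> y; rewrite normrM ler_wpM2r//; exact: kernel_norm.
Qed.

Lemma fold_op_mul_L1 f h : L1 f -> L1 h -> L1 (fun x => f x * fold_op k h x).
Proof.
move=> intf ih.
have /(_ intf) := @L1_bounded _ _ (fold_op k h) f (fold_op_continuous ih) (fun x => fold_op_bounded x ih).
by apply: eq_integrable => // x _ /=; rewrite mulrC.
Qed.

Lemma fold_op_EFin f h x : L1 h -> (forall y, 0 <= h y) ->
  (\int[mu]_y (k x y * h y)%:E)%E = (2 * fold_op k h x)%:E.
Proof.
move=> ih h0; rewrite Rintegral_EFin; last exact: fold_op_integrand_L1.
by rewrite /fold_op mulrA divff// mul1r.
Qed.

(** Tonelli's theorem and the symmetry of k. *)
Lemma fold_op_adjoint f h : L1 f -> L1 h ->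
  (forall x, 0 <= f x) -> (forall x, 0 <= h x) ->
  \int[mu]_x (f x * fold_op k h x) = \int[mu]_x (h x * fold_op k f x).
Proof.
have aux (f1 h1 : R -> R) : L1 f1 -> L1 h1 ->
    (forall x, 0 <= f1 x) -> (forall x, 0 <= h1 x) ->
    ((2 * \int[mu]_x (f1 x * fold_op k h1 x))%:E =
     \int[mu]_x \int[mu]_y (f1 x * k x y * h1 y)%:E)%E.
  move=> if1 ih1 f10 h10.
  rewrite -RintegralZl//; last exact: fold_op_mul_L1.
  rewrite -Rintegral_EFin; last by apply: L1Z; exact: fold_op_mul_L1.
  apply: eq_integral => x _.
  rewrite mulrCA EFinM -fold_op_EFin// -ge0_integralZl//.
  - by under eq_integral do rewrite -EFinM mulrA.
  - by apply/measurable_EFinP; apply: L1_meas; exact: fold_op_integrand_L1.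
  - by move=> y _; rewrite lee_fin mulr_ge0//; exact: kernel_ge0.
  - by rewrite lee_fin.
move=> intf ih f0 h0.
suff : (2 * \int[mu]_x (f x * fold_op k h x))%:E = (2 * \int[mu]_x (h x * fold_op k f x))%:E.
  by case=> /mulfI; apply.
rewrite !aux//.
rewrite (@fubini_tonelli _ _ _ _ _ mu mu (fun z => (f z.1 * k z.1 z.2 * h z.2)%:E)).
- apply: eq_integral => x _; apply: eq_integral => y _ /=.
  by rewrite (kernel_sym kk x y); congr EFin; ring.
- apply/measurable_EFinP; apply: measurable_funM.
    apply: measurable_funM; last exact: kernel_meas.
    by apply: measurableT_comp (L1_meas intf) _; exact: measurable_fst.
  by apply: measurableT_comp (L1_meas ih) _; exact: measurable_snd.
- by move=> z; rewrite lee_fin !mulr_ge0//; exact: kernel_ge0.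
Qed.

Lemma fold_op_eq0 h x : continuous h -> L1 h -> (forall y, 0 <= h y) ->
  fold_op k h x = 0 -> forall y, 0 < k x y -> h y = 0.
Proof.
move=> ch ih h0 /eqP; rewrite mulf_eq0 invr_eq0 pnatr_eq0/= => /eqP I0 y kxy.
suff /eqP : k x y * h y = 0 by rewrite mulf_eq0 gt_eqF//= => /eqP.
apply: (@Rintegral_eq0 _ (fun y => k x y * h y)) => //.
- by move=> z; apply: cvgM; [exact: kernel_continuous|exact: ch].
- by move=> z; rewrite mulr_ge0//; exact: kernel_ge0.
- exact: fold_op_integrand_L1.
Qed.

End kernel_theory.
End operators.

(** * Convolution with the tent on even and on odd functions *)

Section kernels.
Context {R : realType}.
Implicit Types (f g h H : R -> R) (a b x y c t : R) (k : R -> R -> R).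
Local Notation mu := (@lebesgue_measure R).

(** On the half-line, convolution with the tent has the kernel
    tent (x - y) + tent (x + y) on even functions and tent (x - y) - tent (x + y) on
    odd ones.  Both are extended evenly to the line, and an odd function f is
    represented by the even function f |x|. *)
Definition even_kernel x y := tent (`|x| - `|y|) + tent (`|x| + `|y|).
Definition odd_kernel x y := tent (`|x| - `|y|) - tent (`|x| + `|y|).
(** The even kernel minus the rank-one part through which a solution only feels
    its own value at 0, see [even_kernel_split]. *)
Definition reduced_kernel x y := even_kernel x y - 2 * (tent x * tent y).
Definition gap_kernel x y := 2 * (tent x * tent y - tent (`|x| + `|y|)).

Lemma gap_kernelE x y : gap_kernel x y = odd_kernel x y - reduced_kernel x y.
Proof. by rewrite /gap_kernel /reduced_kernel /odd_kernel /even_kernel; ring. Qed.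

Lemma tent_le s t : `|s| <= `|t| -> tent t <= tent s.
Proof.
move=> st; rewrite /tent ge_max le_max lexx/= le_max.
by apply/orP; right; lra.
Qed.

Lemma tent_pos t : 0 <= t -> t <= 1 -> tent t = 1 - t.
Proof. by move=> t0 t1; rewrite tent_in ger0_norm. Qed.

(** If a + b <= 1 the two sides differ by a b. *)
Lemma tentD_le a b : 0 <= a -> 0 <= b -> tent (a + b) <= tent a * tent b.
Proof.
move=> a0 b0; have [ab|ab] := leP 1 (a + b).
  by rewrite tent_out ?mulr_ge0 ?tent_ge0// ger0_norm//; lra.
by rewrite (@tent_pos (a + b)) ?(@tent_pos a) ?(@tent_pos b); nra.
Qed.

(** With [tentD_le] this is the inequality behind the whole uniqueness proof:
    the reduced kernel lies between 0 and the odd kernel. *)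
Lemma tent_mul_le a b : 0 <= a -> 0 <= b ->
  2 * (tent a * tent b) <= tent (a - b) + tent (a + b).
Proof.
wlog ab : a b / a <= b.
  move=> H a0 b0; have [ab|/ltW ba] := leP a b; first exact: H.
  by rewrite (mulrC (tent a)) -(tentN (a - b)) opprB (addrC a); exact: H.
move=> a0 b0; have [b1|b1] := leP 1 b.
  by rewrite [tent b]tent_out ?mulr0 ?addr_ge0 ?tent_ge0// ger0_norm.
rewrite -(tentN (a - b)) opprB (@tent_pos a) ?(@tent_pos b) ?(@tent_pos (b - a)); try lra.
have [ab1|/ltW ab1] := leP 1 (a + b).
  rewrite (@tent_out _ (a + b)); last by rewrite ger0_norm; lra.
  have : 0 <= a * (1 - b) by rewrite mulr_ge0//; lra.
  nra.
rewrite (@tent_pos (a + b)); try lra.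
have : 0 <= a * (1 - b) by rewrite mulr_ge0//; lra.
nra.
Qed.

Lemma odd_kernel_ge0 x y : 0 <= odd_kernel x y.
Proof.
rewrite subr_ge0; apply: tent_le.
have x0 := normr_ge0 x; have y0 := normr_ge0 y.
by rewrite [X in _ <= X]ger0_norm ?addr_ge0// ler_norml; apply/andP; split; lra.
Qed.

Lemma odd_kernel_gt0 x y : x != 0 -> y != 0 -> `| `|x| - `|y| | < 1 -> 0 < odd_kernel x y.
Proof.
rewrite -!normr_gt0 => x0 y0 xy; rewrite subr_gt0.
rewrite [ltRHS]tent_in; last exact: ltW.
have E : `| `|x| - `|y| | < `|x| + `|y|.
  by rewrite ltr_norml; apply/andP; split; lra.
rewrite /tent gt_max; apply/andP; split; first by lra.
by rewrite [`| _ + _|]ger0_norm; lra.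
Qed.

Lemma reduced_kernel_ge0 x y : 0 <= reduced_kernel x y.
Proof.
by rewrite subr_ge0 -(tent_norm x) -(tent_norm y); exact: tent_mul_le.
Qed.

Lemma gap_kernel_ge0 x y : 0 <= gap_kernel x y.
Proof.
rewrite /gap_kernel mulr_ge0// subr_ge0 -(tent_norm x) -(tent_norm y).
exact: tentD_le.
Qed.

Lemma tent_kernel_lip (s : bool) x x' y :
  `|tent (`|x| + (-1) ^+ s * `|y|) - tent (`|x'| + (-1) ^+ s * `|y|)| <= `|x - x'|.
Proof.
apply: le_trans (tent_lipschitz _ _) _.
by rewrite opprD addrACA subrr addr0 ler_dist_dist.
Qed.

Lemma tent_meas2 (f : R * R -> R) : measurable_fun [set: R * R] f ->
  measurable_fun [set: R * R] (fun z => tent (f z)).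
Proof.
by move=> mf; apply: measurableT_comp mf => //;
  exact: continuous_meas (@tent_continuous R).
Qed.

Lemma fst_meas : measurable_fun [set: R * R] (fun z : R * R => `|z.1|).
Proof. by apply: measurableT_comp => //; exact: measurable_fst. Qed.

Lemma snd_meas : measurable_fun [set: R * R] (fun z : R * R => `|z.2|).
Proof. by apply: measurableT_comp => //; exact: measurable_snd. Qed.

Lemma meas_diff : measurable_fun [set: R * R] (fun z : R * R => tent (`|z.1| - `|z.2|)).
Proof.
by apply: tent_meas2; apply: measurable_funB; [exact: fst_meas|exact: snd_meas].
Qed.

Lemma meas_sum : measurable_fun [set: R * R] (fun z : R * R => tent (`|z.1| + `|z.2|)).
Proof.
by apply: tent_meas2; apply: measurable_funD; [exact: fst_meas|exact: snd_meas].
Qed.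

Lemma meas_prod : measurable_fun [set: R * R] (fun z : R * R => tent z.1 * tent z.2).
Proof.
by apply: measurable_funM; apply: tent_meas2; [exact: measurable_fst|exact: measurable_snd].
Qed.

Lemma tent_sym x y : tent (`|x| - `|y|) = tent (`|y| - `|x|).
Proof. by rewrite -tentN opprB. Qed.

Lemma tent_prod_lip x x' y :
  `|tent x * tent y - tent x' * tent y| <= `|x - x'|.
Proof.
rewrite -mulrBl normrM (ger0_norm (tent_ge0 y)).
rewrite -[leRHS]mulr1 ler_pM ?tent_ge0 ?tent_le1//; exact: tent_lipschitz.
Qed.

Lemma kernel_even : kernel even_kernel.
Proof.
apply: Kernel => [x y|x y|x y|x x' y|].
- by rewrite addr_ge0 ?tent_ge0.
- by have := tent_le1 (`|x| - `|y|); have := tent_le1 (`|x| + `|y|); rewrite /even_kernel; lra.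
- by rewrite /even_kernel tent_sym [`|x| + _]addrC.
- have := tent_kernel_lip true x x' y; have := tent_kernel_lip false x x' y.
  rewrite !expr0 !expr1 !mul1r !mulN1r /even_kernel !ler_norml => /andP[? ?] /andP[? ?].
  have := normr_ge0 (x - x').
  by move=> ?; apply/andP; split; lra.
- by apply: measurable_funD; [exact: meas_diff|exact: meas_sum].
Qed.

Lemma kernel_odd : kernel odd_kernel.
Proof.
apply: Kernel => [x y|x y|x y|x x' y|].
- exact: odd_kernel_ge0.
- by have := tent_le1 (`|x| - `|y|); have := tent_ge0 (`|x| + `|y|); rewrite /odd_kernel; lra.
- by rewrite /odd_kernel tent_sym [`|x| + _]addrC.
- have := tent_kernel_lip true x x' y; have := tent_kernel_lip false x x' y.
  rewrite !expr0 !expr1 !mul1r !mulN1r /odd_kernel !ler_norml => /andP[? ?] /andP[? ?].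
  have := normr_ge0 (x - x').
  by move=> ?; apply/andP; split; lra.
- by apply: measurable_funB; [exact: meas_diff|exact: meas_sum].
Qed.

Lemma kernel_gap : kernel gap_kernel.
Proof.
apply: Kernel => [x y|x y|x y|x x' y|].
- exact: gap_kernel_ge0.
- have := reduced_kernel_ge0 x y; have := gap_kernelE x y; have := kernel_le4 kernel_odd x y; lra.
- by rewrite /gap_kernel mulrC [tent x * _]mulrC [`|x| + _]addrC mulrC.
- have := tent_prod_lip x x' y; have := tent_kernel_lip false x x' y.
  rewrite !expr0 !mul1r /gap_kernel !ler_norml => /andP[? ?] /andP[? ?].
  have := normr_ge0 (x - x').
  by move=> ?; apply/andP; split; lra.
- apply: measurable_funM => //.
  by apply: measurable_funB; [exact: meas_prod|exact: meas_sum].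
Qed.

Lemma kernel_reduced : kernel reduced_kernel.
Proof.
apply: Kernel => [x y|x y|x y|x x' y|].
- exact: reduced_kernel_ge0.
- have := gap_kernel_ge0 x y; have := gap_kernelE x y; have := kernel_le4 kernel_odd x y; lra.
- by rewrite /reduced_kernel (kernel_sym kernel_even) [tent x * _]mulrC.
- have := tent_kernel_lip true x x' y; have := tent_kernel_lip false x x' y.
  have := tent_prod_lip x x' y.
  rewrite !expr0 !expr1 !mul1r !mulN1r /reduced_kernel /even_kernel !ler_norml =>
    /andP[? ?] /andP[? ?] /andP[? ?].
  have := normr_ge0 (x - x').
  by move=> ?; apply/andP; split; lra.
- apply: measurable_funB; first exact: kernel_meas kernel_even.
  by apply: measurable_funM => //; exact: meas_prod.
Qed.

Definition tent_conv h x := \int[mu]_y (tent (x - y) * h y).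

Lemma tent_shift_continuous x : continuous (fun y => tent (x - y)).
Proof.
move=> y; apply: (@continuous_comp _ _ _ (fun y => x - y) tent).
  by apply: cvgB; [exact: cvg_cst|exact: cvg_id].
exact: tent_continuous.
Qed.

Lemma tent_norm1 t : `|tent t| <= 1.
Proof. by rewrite ger0_norm ?tent_ge0// tent_le1. Qed.

Lemma tent_conv_L1 h x : L1 h -> L1 (fun y => tent (x - y) * h y).
Proof.
by apply: (@L1_bounded _ 1); [exact: tent_shift_continuous|move=> y; exact: tent_norm1].
Qed.

Lemma tent_conv_opp h x : L1 h -> tent_conv h (- x) = tent_conv (fun y => h (- y)) x.
Proof.
move=> ih; rewrite /tent_conv -(preserves_Rintegral preserves_opp).
  by apply: eq_Rintegral => y _; rewrite -tentN; congr (tent _ * _); ring.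
by apply: L1_meas; exact: tent_conv_L1.
Qed.

(** Average the integral with its image under y |-> -y. *)
Lemma tent_conv_even h x : L1 h -> (forall y, h (- y) = h y) -> tent_conv h x = fold_op even_kernel h x.
Proof.
move=> ih eh.
have E : tent_conv h x + tent_conv h x = \int[mu]_y (even_kernel x y * h y).
  rewrite -{2}[x]opprK tent_conv_opp//.
  have -> : (fun y => h (- y)) = h by apply/funext.
  rewrite /tent_conv -RintegralD//; try exact: tent_conv_L1.
  apply: eq_Rintegral => y _; rewrite -mulrDl /even_kernel; congr (_ * _).
  rewrite -tentN opprB -(tentN (- x - y)) opprD !opprK.
  by case: (ger0P x) => x0; case: (ger0P y) => y0; rewrite ?opprK; 
    [|rewrite addrC|rewrite addrC|]; congr (_ + _); (congr tent; ring) || (rewrite -tentN; congr tent; ring).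
by rewrite /fold_op -E; lra.
Qed.

Lemma tent_conv_odd h x : L1 h -> (forall y, h (- y) = - h y) ->
  tent_conv h `|x| = fold_op odd_kernel (fun y => h `|y|) x.
Proof.
move=> ih oh.
have h0 : h 0 = 0 by have := oh 0; rewrite oppr0; lra.
have E : tent_conv h `|x| + tent_conv h `|x| = \int[mu]_y (odd_kernel x y * h `|y|).
  rewrite -{2}[`|x|]opprK tent_conv_opp//.
  rewrite /tent_conv -RintegralD//; try exact: tent_conv_L1; last first.
    by apply: tent_conv_L1; exact: L1_opp.
  apply: eq_Rintegral => y _; rewrite /odd_kernel.
  have -> : tent (- `|x| - y) = tent (`|x| + y).
    by rewrite -tentN; congr tent; ring.
  have [y0|y0] := ger0P y; first by rewrite oh; ring.
  by rewrite opprK oh; ring.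
by rewrite /fold_op -E; lra.
Qed.

End kernels.

(** * Positivity arguments *)

Section positivity.
Context {R : realType}.
Implicit Types (f g h H : R -> R) (a b x y c t : R) (k : R -> R -> R).
Local Notation mu := (@lebesgue_measure R).

Definition pos_part h x := (`|h x| + h x) / 2.

Lemma pos_part_ge0 h x : 0 <= pos_part h x.
Proof. by rewrite divr_ge0// -lerBlDr sub0r -normrN ler_norm. Qed.

Lemma pos_part_ge h x : h x <= pos_part h x.
Proof. by rewrite /pos_part; have := ler_norm (h x); lra. Qed.

Lemma pos_part_le h x c : 0 <= c -> h x <= c -> pos_part h x <= c.
Proof. by move=> c0 hc; rewrite /pos_part; case: (ger0P (h x)) => ?; lra. Qed.

Lemma pos_part_eq0 h x : h x <= 0 -> pos_part h x = 0.
Proof. by move=> h0; rewrite /pos_part ler0_norm//; lra. Qed.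

Lemma norm_continuous_comp h : continuous h -> continuous (fun x => `|h x|).
Proof.
move=> ch x; apply: (@continuous_comp _ _ _ h (fun z => `|z|)); first exact: ch.
exact: norm_continuous.
Qed.

Lemma pos_part_continuous h : continuous h -> continuous (pos_part h).
Proof.
move=> ch x; apply: cvgM; last exact: cvg_cst.
by apply: cvgD; [exact: (norm_continuous_comp ch)|exact: ch].
Qed.

Lemma pos_part_L1 h : L1 h -> L1 (pos_part h).
Proof.
move=> ih; rewrite /pos_part.
have -> : (fun x => (`|h x| + h x) / 2) = (fun x => 2^-1 * (`|h x| + h x)).
  by apply/funext => x; rewrite mulrC.
by apply/L1Z/L1D => //; exact: L1_norm.
Qed.

Lemma continuous_zero_off0 f : continuous f -> (forall x, x != 0 -> f x = 0) ->
  forall x, f x = 0.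
Proof.
move=> cf f0 x; have [->|/f0//] := eqVneq x 0.
apply/eqP/negPn/negP => n0.
have /cvgrPdist_lt/(_ `|f 0|) := cf 0.
rewrite normr_gt0 => /(_ n0) [e /= e0 He].
have e2 : 0 < e / 2 by rewrite divr_gt0.
have := He (e / 2); rewrite /= sub0r normrN gtr0_norm// (f0 (e / 2)) ?gt_eqF//.
by rewrite subr0 ltxx; move=> H; suff : false by []; apply: H; lra.
Qed.

(** Steps of length 1/2 lead from x1 to any positive number. *)
Lemma chain_pos (P : R -> Prop) x1 : 0 < x1 -> P x1 ->
  (forall x y, 0 < x -> 0 < y -> `|x - y| < 1 -> P x -> P y) ->
  forall y, 0 < y -> P y.
Proof.
move=> x10 Px1 step.
have aux n : forall y, 0 < y -> `|y - x1| <= n%:R / 2 -> P y.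
  elim: n => [|n IH] y y0.
    by rewrite mul0r normr_le0 subr_eq0 => /eqP ->.
  move=> yx; have [h|h] := leP `|y - x1| (1 / 2).
    by apply: (step x1) => //; rewrite distrC; lra.
  move: yx h; rewrite -natr1; have [yx|yx] := ler0P (y - x1) => h1 h2.
    apply: (step (y + 1 / 2)) => //; first by lra.
      by rewrite ger0_norm; lra.
    by apply: IH; [lra|rewrite ler0_norm; lra].
  apply: (step (y - 1 / 2)) => //; first by lra.
    by rewrite ler0_norm; lra.
  by apply: IH; [lra|rewrite ger0_norm; lra].
move=> y y0; pose n := Num.bound (2 * `|y - x1|).
apply: (aux n) => //.
have := @archi_boundP R (2 * `|y - x1|) (ltac:(by rewrite mulr_ge0)).
by rewrite -/n; lra.
Qed.

Section perron.
Context (p : R -> R) (P : R).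
Context (cp : continuous p) (p0 : forall x, 0 < p x) (pP : forall x, p x <= P).
Context (pe : forall x, p (- x) = p x).

Lemma coef_norm x : `|p x| <= P.
Proof. by rewrite ger0_norm ?pP// ltW. Qed.

Lemma coef_L1 h : L1 h -> L1 (fun x => p x * h x).
Proof. by apply: L1_bounded; [exact: cp|exact: coef_norm]. Qed.

Lemma coef_continuous h : continuous h -> continuous (fun x => p x * h x).
Proof. by move=> ch x; apply: cvgM; [exact: cp|exact: ch]. Qed.

Lemma coef_ge0 h : (forall x, 0 <= h x) -> forall x, 0 <= p x * h x.
Proof. by move=> h0 x; rewrite mulr_ge0// ltW. Qed.

(** Strong maximum principle: at a zero of h the integral of a nonnegative
    integrand vanishes, so that the zero spreads to all points at distance less
    than one, and from there to the whole line. *)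
Lemma odd_solution_positivity h : continuous h -> L1 h -> (forall x, 0 <= h x) ->
  (forall x, h `|x| = h x) ->
  (forall x, x != 0 -> h x = fold_op odd_kernel (fun y => p y * h y) x) ->
  forall x1, x1 != 0 -> h x1 = 0 -> forall x, h x = 0.
Proof.
move=> ch ih h0 eh hK x1 x10 hx1.
apply: continuous_zero_off0 => // x x0.
rewrite -eh; apply: (@chain_pos (fun x => h x = 0) `|x1|); rewrite ?normr_gt0 ?eh//.
move=> y z y0 z0 yz hy.
have /(_ z) := fold_op_eq0 kernel_odd (coef_continuous ch) (coef_L1 ih) (coef_ge0 h0)
  (etrans (esym (hK y (lt0r_neq0 y0))) hy).
rewrite odd_kernel_gt0 ?(gt_eqF y0) ?(gt_eqF z0) ?(gtr0_norm y0) ?(gtr0_norm z0)//.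
by move=> /(_ isT)/eqP; rewrite mulf_eq0 gt_eqF//= => /eqP.
Qed.

Context (u : R -> R).
Context (cu : continuous u) (iu : L1 u) (u0 : forall x, x != 0 -> 0 < u x).
Context (uge0 : forall x, 0 <= u x).
Context (uK : forall x, u x = fold_op odd_kernel (fun y => p y * u y) x).

(** By symmetry of the kernel K, pairing K (p h) - h with p u gives the integral
    of p h (K (p u) - u), which is 0; but the first integrand is nonnegative. *)
Lemma odd_subsolution_eq h : continuous h -> L1 h -> (forall x, 0 <= h x) ->
  (forall x, h x <= fold_op odd_kernel (fun y => p y * h y) x) ->
  forall x, x != 0 -> h x = fold_op odd_kernel (fun y => p y * h y) x.
Proof.
move=> ch ih h0 hK x x0.
pose Kh := fold_op odd_kernel (fun y => p y * h y).
have iph := coef_L1 ih; have ipu := coef_L1 iu.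
have cK : continuous Kh by exact: fold_op_continuous kernel_odd _ iph.
have i1 : L1 (fun x => p x * u x * Kh x) by exact: (fold_op_mul_L1 kernel_odd).
have i2 : L1 (fun x => p x * u x * h x).
  have := fold_op_mul_L1 kernel_odd iph ipu.
  by apply: eq_integrable => // y _ /=; rewrite -uK mulrAC.
have I0 : \int[mu]_x (p x * u x * (Kh x - h x)) = 0.
  under eq_Rintegral do rewrite mulrBr.
  rewrite RintegralB// (fold_op_adjoint kernel_odd)//; [|exact: coef_ge0..].
  apply/eqP; rewrite subr_eq0; apply/eqP; apply: eq_Rintegral => y _.
  by rewrite -uK mulrAC.
have := @Rintegral_eq0 _ (fun x => p x * u x * (Kh x - h x)).
move=> /(_ _ _ _ I0 x); rewrite -/(Kh x).
have H1 : continuous (fun x => p x * u x * (Kh x - h x)).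
  move=> y; apply: cvgM; first exact: coef_continuous.
  by apply: cvgB; [exact: cK|exact: ch].
have H2 y : 0 <= p y * u y * (Kh y - h y).
  by rewrite mulr_ge0 ?coef_ge0// subr_ge0.
have H3 : L1 (fun x => p x * u x * (Kh x - h x)).
  have := L1B i1 i2.
  by apply: eq_integrable => // y _ /=; rewrite mulrBr.
move=> /(_ H1 H2 H3)/eqP.
by rewrite 2!mulf_eq0 (gt_eqF (p0 x)) (gt_eqF (u0 x0))/= subr_eq0 => /eqP ->.
Qed.

(** The positive and the negative part of h are subsolutions, hence solutions by
    [odd_subsolution_eq]; as they vanish at 1 they vanish everywhere. *)
Lemma odd_solution_zero h : continuous h -> L1 h -> (forall x, h `|x| = h x) ->
  (forall x, h x = fold_op odd_kernel (fun y => p y * h y) x) ->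
  h 1 = 0 -> forall x, h x = 0.
Proof.
have aux (f : R -> R) : continuous f -> L1 f -> (forall x, f `|x| = f x) ->
  (forall x, f x = fold_op odd_kernel (fun y => p y * f y) x) ->
  f 1 = 0 -> forall x, f x <= 0.
  move=> cf intf ef fK f1 x.
  have qc := pos_part_continuous cf; have qi := pos_part_L1 intf.
  have q0 := pos_part_ge0 f.
  have qK y : pos_part f y <= fold_op odd_kernel (fun y => p y * pos_part f y) y.
    apply: pos_part_le; first by apply: (fold_op_ge0 kernel_odd); exact: coef_ge0.
    rewrite fK; apply: (fold_op_mono kernel_odd); [exact: coef_L1|exact: coef_L1|move=> z].
    by rewrite ler_wpM2l ?pos_part_ge// ltW.
  apply: le_trans (pos_part_ge f x) _.
  rewrite (@odd_solution_positivity (pos_part f) qc qi q0 _ (odd_subsolution_eq qc qi q0 qK) 1)//.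
  - by move=> y; rewrite /pos_part ef.
  - by rewrite pos_part_eq0// f1.
move=> ch ih eh hK h1 x.
apply/eqP; rewrite eq_le aux//= -oppr_le0.
apply: (aux (fun x => - h x)) => //.
- by move=> y; apply: cvgN; exact: ch.
- have := L1Z (-1) ih; by apply: eq_integrable => // y _ /=; rewrite mulN1r.
- by move=> y; rewrite eh.
- move=> y; rewrite {1}hK -mulN1r -(fold_opZ kernel_odd)//; last exact: coef_L1.
  by congr fold_op; apply/funext => z; ring.
- by rewrite h1 oppr0.
Qed.

(** The rank-one part of the kernel integrates to the value at 0. *)
Lemma even_kernel_split h x : L1 h ->
  fold_op even_kernel h x = fold_op reduced_kernel h x + tent x * fold_op even_kernel h 0.
Proof.
move=> ih.
have -> : fold_op even_kernel h 0 = \int[mu]_y (tent y * h y).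
  rewrite /fold_op -RintegralZl//; last exact: (fold_op_integrand_L1 kernel_even).
  apply: eq_Rintegral => y _; rewrite /even_kernel normr0 sub0r add0r tentN !tent_norm.
  lra.
rewrite -RintegralZl//; last first.
  by apply: (@L1_bounded _ 1) => //; [exact: tent_continuous|exact: tent_norm1].
rewrite /fold_op -!RintegralZl//; try exact: (fold_op_integrand_L1 kernel_even); try exact: (fold_op_integrand_L1 kernel_reduced).
rewrite -RintegralD//.
- by apply: eq_Rintegral => y _; rewrite /reduced_kernel; lra.
- by apply: L1Z; exact: (fold_op_integrand_L1 kernel_reduced).
- by apply/L1Z/(@L1_bounded _ 1) => //; [exact: tent_continuous|exact: tent_norm1].
Qed.

Lemma gap_kernel_op h x : L1 h -> fold_op gap_kernel h x = fold_op odd_kernel h x - fold_op reduced_kernel h x.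
Proof.
move=> ih; rewrite /fold_op -mulrBr -RintegralB//; try exact: (fold_op_integrand_L1 kernel_odd);
  try exact: (fold_op_integrand_L1 kernel_reduced).
by congr (_ * _); apply: eq_Rintegral => y _; rewrite gap_kernelE mulrBl.
Qed.

(** The rank-one term has the sign of h 0, so the negative part q of h satisfies
    q <= K_red (p q) <= K_odd (p q).  By [odd_subsolution_eq] both are equalities,
    and since the gap between the two kernels is positive at (1/2, 1/2) this
    forces q (1/2) = 0 and then q = 0. *)
Lemma even_solution_ge0 h : continuous h -> L1 h -> (forall x, h `|x| = h x) ->
  (forall x, h x = fold_op even_kernel (fun y => p y * h y) x) ->
  0 <= h 0 -> forall x, 0 <= h x.
Proof.
move=> ch ih eh hK h00 x.
pose f x := - h x.
have cf : continuous f by move=> y; apply: cvgN; exact: ch.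
have intf : L1 f.
  by have := L1Z (-1) ih; apply: eq_integrable => // y _ /=; rewrite mulN1r.
have qc := pos_part_continuous cf; have qi := pos_part_L1 intf.
have q0 := pos_part_ge0 f.
have pq0 := coef_ge0 q0.
have ipq := coef_L1 qi.
have qK' y : pos_part f y <= fold_op reduced_kernel (fun y => p y * pos_part f y) y.
  apply: pos_part_le; first exact: (fold_op_ge0 kernel_reduced).
  rewrite /f hK even_kernel_split; last exact: coef_L1.
  rewrite -hK opprD.
  rewrite (@le_trans _ _ (- fold_op reduced_kernel (fun y => p y * h y) y))//.
    by rewrite gerDl oppr_le0 mulr_ge0 ?tent_ge0.
  rewrite -mulN1r -(fold_opZ kernel_reduced)//; last exact: coef_L1.
  apply: (fold_op_mono kernel_reduced) => // [|z]; first by apply: L1Z; exact: coef_L1.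
  rewrite mulrCA ler_wpM2l ?(ltW (p0 _))// mulN1r.
  exact: pos_part_ge f z.
have gapq y : fold_op gap_kernel (fun y => p y * pos_part f y) y =
    fold_op odd_kernel (fun y => p y * pos_part f y) y - fold_op reduced_kernel (fun y => p y * pos_part f y) y.
  exact: gap_kernel_op.
have gapq0 y : 0 <= fold_op gap_kernel (fun y => p y * pos_part f y) y.
  exact: (fold_op_ge0 kernel_gap).
have qK y : pos_part f y <= fold_op odd_kernel (fun y => p y * pos_part f y) y.
  by have := qK' y; have := gapq0 y; rewrite gapq; lra.
have qE := odd_subsolution_eq qc qi q0 qK.
(* The gap kernel is 1/2 at (1/2, 1/2). *)
have half0 : (2^-1 : R) != 0 by rewrite invr_eq0 pnatr_eq0.
have g0 : fold_op gap_kernel (fun y => p y * pos_part f y) 2^-1 = 0.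
  have := gapq0 2^-1; rewrite gapq -qE//; have := qK' 2^-1; lra.
have := fold_op_eq0 kernel_gap (coef_continuous qc) ipq pq0 g0 (y := 2^-1).
have -> : 0 < gap_kernel (2^-1 : R) 2^-1.
  rewrite /gap_kernel ger0_norm// (@tent_pos _ 2^-1)//; last by lra.
  by rewrite (@tent_out _ (2^-1 + 2^-1)) ?ger0_norm; lra.
move=> /(_ isT)/eqP; rewrite mulf_eq0 gt_eqF//= => /eqP qh.
have := @odd_solution_positivity (pos_part f) qc qi q0 _ qE 2^-1 half0 qh x.
have E y : pos_part f `|y| = pos_part f y by rewrite /pos_part /f eh.
by move=> /(_ E); have := pos_part_ge f x; rewrite /f; lra.
Qed.

Context (r g : R -> R).
Context (cr : continuous r) (cg : continuous g) (ig : L1 g).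
Context (r0 : forall x, 0 < r x) (g0 : forall x, 0 <= g x).
Context (gr : forall x, g x < p x * r x).
Context (rK : forall x, r x = fold_op even_kernel g x).

(** Pairing the equation of h with that of r gives that h (p r - g) has integral
    zero, while p r - g > 0. *)
Lemma nonneg_solution_zero h : continuous h -> L1 h -> (forall x, 0 <= h x) ->
  (forall x, h x = fold_op even_kernel (fun y => p y * h y) x) ->
  forall x, h x = 0.
Proof.
move=> ch ih h0 hK x.
have iph := coef_L1 ih.
have i1 : L1 (fun x => g x * h x).
  have := fold_op_mul_L1 kernel_even ig iph.
  by apply: eq_integrable => // y _ /=; rewrite -hK.
have i2 : L1 (fun x => p x * h x * r x).
  have := fold_op_mul_L1 kernel_even iph ig.
  by apply: eq_integrable => // y _ /=; rewrite -rK.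
have E : \int[mu]_x (g x * h x) = \int[mu]_x (p x * h x * r x).
  have := fold_op_adjoint kernel_even ig iph g0 (coef_ge0 h0).
  under eq_Rintegral do rewrite -hK.
  by under [in RHS]eq_Rintegral do rewrite -rK.
have I0 : \int[mu]_x (h x * (p x * r x - g x)) = 0.
  have -> : \int[mu]_x (h x * (p x * r x - g x)) =
      \int[mu]_x (p x * h x * r x - g x * h x).
    by apply: eq_Rintegral => y _; ring.
  by rewrite RintegralB// E subrr.
have := @Rintegral_eq0 _ (fun x => h x * (p x * r x - g x)) _ _ _ I0 x.
have H1 : continuous (fun x => h x * (p x * r x - g x)).
  move=> y; apply: cvgM; first exact: ch.
  by apply: cvgB; [exact: coef_continuous|exact: cg].
have H2 y : 0 <= h y * (p y * r y - g y).
  by rewrite mulr_ge0// subr_ge0 ltW.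
have H3 : L1 (fun x => h x * (p x * r x - g x)).
  have := L1B i2 i1.
  by apply: eq_integrable => // y _ /=; congr EFin; ring.
move=> /(_ H1 H2 H3)/eqP; rewrite mulf_eq0 => /orP[/eqP//|].
by rewrite gt_eqF// subr_gt0.
Qed.

Lemma even_solution_zero h : continuous h -> L1 h -> (forall x, h `|x| = h x) ->
  (forall x, h x = fold_op even_kernel (fun y => p y * h y) x) ->
  forall x, h x = 0.
Proof.
move=> ch ih eh hK x.
have [h00|/ltW h00] := leP 0 (h 0).
  apply: nonneg_solution_zero => //; exact: even_solution_ge0.
pose f x := - h x.
have cf : continuous f by move=> y; apply: cvgN; exact: ch.
have intf : L1 f.
  by have := L1Z (-1) ih; apply: eq_integrable => // y _ /=; rewrite mulN1r.
have fK y : f y = fold_op even_kernel (fun y => p y * f y) y.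
  rewrite /f {1}hK -mulN1r -(fold_opZ kernel_even)//; last exact: coef_L1.
  by congr fold_op; apply/funext => z; ring.
have ef y : f `|y| = f y by rewrite /f eh.
have f00 : 0 <= f 0 by rewrite oppr_ge0.
have := nonneg_solution_zero cf intf (even_solution_ge0 cf intf ef fK f00) fK x.
by rewrite /f => /eqP; rewrite oppr_eq0 => /eqP.
Qed.

End perron.
End positivity.

(** * The solutions of the linear convolution equation *)

Section solutions.
Context {R : realType}.
Implicit Types (f g h H : R -> R) (a b x y c t : R) (k : R -> R -> R).
Local Notation mu := (@lebesgue_measure R).

Lemma even_norm f : (forall x, f (- x) = f x) -> forall x, f `|x| = f x.
Proof. by move=> fe x; case: (ger0P x). Qed.

Lemma tent_convZ c h x : L1 h -> tent_conv (fun y => c * h y) x = c * tent_conv h x.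
Proof.
move=> ih; rewrite /tent_conv -(@RintegralZl _ _ _ mu setT _ c)//; last exact: tent_conv_L1.
by apply: eq_Rintegral => y _; ring.
Qed.

Lemma tent_convD h h' x : L1 h -> L1 h' ->
  tent_conv (fun y => h y + h' y) x = tent_conv h x + tent_conv h' x.
Proof.
move=> ih ih'; rewrite /tent_conv -RintegralD//; try exact: tent_conv_L1.
by apply: eq_Rintegral => y _; ring.
Qed.

(** The even part of S vanishes by [even_solution_zero]; the odd part minus the
    multiple of w with the same value at 1 vanishes by [odd_solution_zero]. *)
Theorem tent_conv_solutions (p w r g S : R -> R) (P : R) :
  continuous p -> (forall x, 0 < p x) -> (forall x, p x <= P) ->
  (forall x, p (- x) = p x) ->
  continuous w -> L1 w -> (forall x, w (- x) = - w x) ->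
  (forall x, 0 < x -> 0 < w x) ->
  (forall x, w x = tent_conv (fun y => p y * w y) x) ->
  continuous r -> (forall x, 0 < r x) ->
  continuous g -> L1 g -> (forall x, 0 <= g x) -> (forall x, g (- x) = g x) ->
  (forall x, r x = tent_conv g x) -> (forall x, g x < p x * r x) ->
  continuous S -> L1 S -> (forall x, S x = tent_conv (fun y => p y * S y) x) ->
  exists c, forall x, S x = c * w x.
Proof.
move=> cp p0 pP pe cw iw wo w0 wK cr r0 cg ig g0 ge rg gr cS iS SK.
have pL (h : R -> R) : L1 h -> L1 (fun x => p x * h x) by exact: (coef_L1 cp p0 pP).
have cN f : continuous f -> continuous (fun x => f (- x)).
  move=> cf x; apply: (@continuous_comp _ _ _ (fun x => - x) f); last exact: cf.
  exact: opp_continuous.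
have cA f : continuous f -> continuous (fun x => f `|x|).
  move=> cf x; apply: (@continuous_comp _ _ _ (fun x => `|x|) f); last exact: cf.
  exact: norm_continuous.
have iSo : L1 (fun x => S (- x)) by exact: L1_opp.
have SKo x : S (- x) = tent_conv (fun y => p y * S (- y)) x.
  rewrite SK tent_conv_opp; last exact: pL.
  by congr tent_conv; apply/funext => y; rewrite pe.
have lin c : L1 (fun x => S x + c * S (- x)) by apply: L1D => //; exact: L1Z.
have linc c : continuous (fun x => S x + c * S (- x)).
  move=> x; apply: cvgD; first exact: cS.
  by apply: cvgM; [exact: cvg_cst|exact: cN].
have linK c x : S x + c * S (- x) = tent_conv (fun y => p y * (S y + c * S (- y))) x.
  rewrite {1}SK {1}SKo -tent_convZ; last exact: pL.
  rewrite -tent_convD; [|exact: pL|by apply/L1Z/pL].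
  by congr tent_conv; apply/funext => y; ring.
have wa : L1 (fun x => w `|x|).
  apply: (@L1_le _ _ w) => //; first exact: continuous_meas (cA _ cw).
  by move=> y; case: (ger0P y) => // _; rewrite wo normrN.
have waK y : w `|y| = fold_op odd_kernel (fun z => p z * w `|z|) y.
  rewrite wK tent_conv_odd; [|exact: pL|by move=> z; rewrite pe wo mulrN].
  by congr fold_op; apply/funext => z; rewrite (even_norm pe).
have wge y : 0 <= w `|y|.
  have [->|y0] := eqVneq y 0; last by rewrite ltW// w0// normr_gt0.
  by rewrite normr0; have := wo 0; rewrite oppr0; lra.
have wgt y : y != 0 -> 0 < w `|y| by move=> y0; rewrite w0// normr_gt0.
have ev x : S x + 1 * S (- x) = 0.
  pose h y := S y + 1 * S (- y).
  have eh y : h (- y) = h y by rewrite /h opprK; ring.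
  have hK y : h y = fold_op even_kernel (fun z => p z * h z) y.
    rewrite {1}/h linK tent_conv_even//; first by apply: pL; exact: lin.
    by move=> z; rewrite pe; congr (_ * _); exact: eh.
  have rK y : r y = fold_op even_kernel g y by rewrite rg tent_conv_even.
  have := @even_solution_zero _ p P cp p0 pP (fun x => w `|x|) (cA _ cw) wa wgt wge waK
    r g cr cg ig g0 gr rK h (linc 1) (lin 1) (even_norm eh) hK x.
  by [].
have Sodd x : S (- x) = - S x by have := ev x; lra.
exists (S 1 / w 1) => x.
pose c := S 1 / w 1.
pose D y := S y - c * w y.
have iD : L1 D by apply: L1B => //; exact: L1Z.
have cD : continuous D.
  move=> y; apply: cvgB; first exact: cS.
  by apply: cvgM; [exact: cvg_cst|exact: cw].
have oD y : D (- y) = - D y by rewrite /D Sodd wo; ring.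
have DK y : D y = tent_conv (fun z => p z * D z) y.
  rewrite {1}/D {1}SK {1}wK -tent_convZ; last exact: pL.
  rewrite -mulN1r -tent_convZ; last by apply/L1Z/pL.
  rewrite -tent_convD; [|exact: pL|by apply/L1Z/L1Z/pL].
  by congr tent_conv; apply/funext => z; rewrite /D; ring.
have D1 : D `|1| = 0.
  by rewrite normr1 /D /c divfK ?subrr// gt_eqF// w0.
have DKa y : D `|y| = fold_op odd_kernel (fun z => p z * D `|z|) y.
  rewrite DK tent_conv_odd; [|exact: pL|by move=> z; rewrite pe oD mulrN].
  by congr fold_op; apply/funext => z; rewrite (even_norm pe).
have iDa : L1 (fun x => D `|x|).
  apply: (@L1_le _ _ D) => //; first exact: continuous_meas (cA _ cD).
  by move=> y; case: (ger0P y) => // _; rewrite oD normrN.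
have D0 y : D `|y| = 0.
  apply: (@odd_solution_zero _ p P cp p0 pP (fun x => w `|x|) (cA _ cw) wa wgt wge waK
    (fun x => D `|x|)) => //; first exact: cA.
  by move=> z; rewrite normr_id.
have : D x = 0.
  by have := D0 x; case: (ger0P x) => // _; rewrite oD => /eqP; rewrite oppr_eq0 => /eqP.
by rewrite /D -/c; lra.
Qed.

End solutions.

(** * The interaction potential *)

Section potential.
Context {R : realType} (m : R) (m_gt1 : 1 < m).
Implicit Types (r x y : R).

Definition dPhi r : R := (m + 1)^-1 * ((1 - r) `^ (- (m + 1)) - 1).
Definition d2Phi r : R := (1 - r) `^ (- (m + 2)).

Lemma is_derive_powR_onem (s r : R) : r < 1 ->
  is_derive r 1 (fun x => (1 - x) `^ s) (- (s * (1 - r) `^ (s - 1))).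
Proof.
move=> r1.
have d1 : is_derive r 1 (fun x : R => 1 - x) (-1).
  by rewrite -[X in is_derive _ _ _ X]add0r; apply: is_deriveB.
have r10 : 0 < 1 - r by rewrite subr_gt0.
have := @is_derive1_comp R (fun x => x `^ s) (fun x => 1 - x) r _ _
  (is_derive1_powR s r10) d1.
by rewrite mulrN1.
Qed.

Lemma is_derive_Phi r : r < 1 -> is_derive r 1 (Phi m) (dPhi r).
Proof.
move=> r1.
have d1 := is_derive_powR_onem (- m) r1.
have -> : Phi m = (fun x => (m * (m + 1))^-1 * ((1 - x) `^ (- m) - m * x - 1)).
  by apply/funext => x; rewrite /Phi powRN.
apply: is_derive_eq.
rewrite /dPhi /GRing.scale/= opprD.
set X := (1 - r) `^ (_ - _).
have m0 : m != 0 by rewrite gt_eqF//; have := m_gt1; lra.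
have m10 : m + 1 != 0 by rewrite gt_eqF//; have := m_gt1; lra.
field.
by apply/andP.
Qed.

Lemma is_derive_dPhi r : r < 1 -> is_derive r 1 dPhi (d2Phi r).
Proof.
move=> r1.
have d1 := is_derive_powR_onem (- (m + 1)) r1.
rewrite /dPhi.
apply: is_derive_eq.
rewrite /d2Phi /GRing.scale/=.
have -> : - (m + 1) - 1 = - (m + 2) by ring.
have m10 : m + 1 != 0 by rewrite gt_eqF//; have := m_gt1; lra.
by field.
Qed.

Lemma near_lt1 r : r < 1 -> \forall x \near r, x < 1.
Proof. exact: lt_nbhsl. Qed.

Lemma derive1_Phi r : r < 1 -> ((Phi m)^`())%classic r = dPhi r.
Proof. by move=> r1; rewrite derive1E; case: (is_derive_Phi r1). Qed.

Lemma derive2_Phi r : r < 1 -> ((Phi m)^`(2))%classic r = d2Phi r.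
Proof.
move=> r1; rewrite derive1nS derive1E.
have d := is_derive_dPhi r1.
have [] // : is_derive r 1 ((Phi m)^`())%classic (d2Phi r).
apply: near_eq_is_derive d.
by near=> x; rewrite derive1_Phi//; near: x; exact: near_lt1.
Unshelve. all: by end_near. Qed.

Lemma dPhi0 : dPhi 0 = 0.
Proof. by rewrite /dPhi subr0 powR1 subrr mulr0. Qed.

Lemma Phi0 : Phi m 0 = 0.
Proof. by rewrite /Phi subr0 powR1 invr1 mulr0 subr0 subrr mulr0. Qed.

Lemma d2Phi_gt0 r : r < 1 -> 0 < d2Phi r.
Proof. by move=> r1; rewrite powR_gt0// subr_gt0. Qed.

Lemma d2Phi_incr x y : x < y -> y < 1 -> d2Phi x < d2Phi y.
Proof.
move=> xy y1; have x1 : x < 1 by exact: lt_trans xy y1.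
rewrite /d2Phi !powRN ltf_pV2 ?posrE ?powR_gt0 ?subr_gt0//.
by have := m_gt1 => mg; rewrite gt0_ltr_powR ?nnegrE//; lra.
Qed.

Lemma d2Phi_le x y : x <= y -> y < 1 -> d2Phi x <= d2Phi y.
Proof.
by rewrite le_eqVlt => /predU1P[->//|xy] y1; rewrite ltW// d2Phi_incr.
Qed.

Lemma is_derive_cont (f : R -> R) r l : is_derive r 1 f l -> {for r, continuous f}.
Proof.
by move=> [d _]; apply: differentiable_continuous; apply/derivable1_diffP.
Qed.

Lemma continuous_dPhi r : r < 1 -> {for r, continuous dPhi}.
Proof. by move=> /is_derive_dPhi/is_derive_cont. Qed.

Lemma continuous_d2Phi r : r < 1 -> {for r, continuous d2Phi}.
Proof. by move=> r1; apply: is_derive_cont; exact: is_derive_powR_onem. Qed.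

(** Phi''(0) = 1, and 2 leaves room for the tails of the profile. *)
Lemma d2Phi_small : exists2 e, 0 < e < 1 & forall r, r <= e -> d2Phi r <= 2.
Proof.
have /cvgrPdist_lt/(_ 1 ltr01) [e /= e0 He] := continuous_d2Phi (@ltr01 R).
pose d := Num.min (e / 2) 2^-1.
have d0 : 0 < d by rewrite lt_min; apply/andP; split; [rewrite divr_gt0|lra].
have d1 : d <= 2^-1 by rewrite ge_min lexx orbT.
have de : d <= e / 2 by rewrite ge_min lexx.
exists d; first by apply/andP; split; lra.
move=> r rd; apply: le_trans (d2Phi_le rd _) _; first by lra.
have := He d; rewrite /= sub0r normrN gtr0_norm//.
have -> : d2Phi 0 = 1 by rewrite /d2Phi subr0 powR1.
move=> H; have : `|1 - d2Phi d| < 1 by apply: H; lra.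
by rewrite ltr_norml => /andP[]; lra.
Qed.

Lemma MVT_lt1 (f df : R -> R) r : 0 < r -> r < 1 ->
  (forall x, x < 1 -> is_derive x 1 f (df x)) ->
  exists2 c, 0 < c < r & f r - f 0 = df c * r.
Proof.
move=> r0 r1 d.
have [||c] := @MVT R f df 0 r r0.
- by move=> x; rewrite in_itv/= => /andP[x0 xr]; apply: d; lra.
- apply: continuous_in_subspaceT => x; rewrite inE/= in_itv/= => /andP[x0 xr].
  by apply: is_derive_cont; apply: d; lra.
by rewrite in_itv/= subr0 => cr E; exists c.
Qed.

(** Phi' vanishes at 0 and is strictly convex on [0, 1[. *)
Lemma dPhi_lt r : 0 < r -> r < 1 -> dPhi r < d2Phi r * r.
Proof.
move=> r0 r1; have [c /andP[c0 cr]] := MVT_lt1 r0 r1 is_derive_dPhi.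
by rewrite dPhi0 subr0 => ->; rewrite ltr_pM2r// d2Phi_incr.
Qed.

Lemma dPhi_gt0 r : 0 < r -> r < 1 -> 0 < dPhi r.
Proof.
move=> r0 r1; have [c /andP[c0 cr]] := MVT_lt1 r0 r1 is_derive_dPhi.
by rewrite dPhi0 subr0 => ->; rewrite mulr_gt0// d2Phi_gt0; lra.
Qed.

Lemma dPhi_ge0 r : 0 <= r -> r < 1 -> 0 <= dPhi r.
Proof.
by rewrite le_eqVlt => /predU1P[<-|r0] r1; rewrite ?dPhi0// ltW// dPhi_gt0.
Qed.

Lemma dPhi_le_mul r : 0 <= r -> r < 1 -> dPhi r <= d2Phi r * r.
Proof.
rewrite le_eqVlt => /predU1P[<-|r0] r1; first by rewrite dPhi0 mulr0.
by rewrite ltW// dPhi_lt.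
Qed.

Lemma dPhi_incr x y : 0 <= x -> x <= y -> y < 1 -> dPhi x <= dPhi y.
Proof.
move=> x0; rewrite le_eqVlt => /predU1P[->//|xy] y1.
have [||c] := @MVT R dPhi d2Phi x y xy.
- by move=> z; rewrite in_itv/= => /andP[? ?]; apply: is_derive_dPhi; lra.
- apply: continuous_in_subspaceT => z; rewrite inE/= in_itv/= => /andP[? ?].
  by apply: continuous_dPhi; lra.
rewrite in_itv/= => /andP[c0 cr] E; rewrite -subr_ge0 E mulr_ge0//; last by lra.
by rewrite ltW// d2Phi_gt0; lra.
Qed.

(** Convexity and Phi(0) = 0. *)
Lemma Phi_le r : 0 <= r -> r < 1 -> Phi m r <= r * dPhi r.
Proof.
rewrite le_eqVlt => /predU1P[<-|r0] r1; first by rewrite Phi0 mul0r.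
have [c /andP[c0 cr]] := MVT_lt1 r0 r1 is_derive_Phi.
by rewrite Phi0 subr0 mulrC => ->; rewrite ler_wpM2l ?(ltW r0)// dPhi_incr// ltW.
Qed.

Lemma Phi_ge0 r : 0 <= r -> r < 1 -> 0 <= Phi m r.
Proof.
rewrite le_eqVlt => /predU1P[<-|r0] r1; first by rewrite Phi0.
have [c /andP[c0 cr]] := MVT_lt1 r0 r1 is_derive_Phi.
by rewrite Phi0 subr0 => ->; rewrite mulr_ge0 ?(ltW r0)// dPhi_ge0; lra.
Qed.

End potential.

(** * Exponential decay *)

Section decay.
Context {R : realType}.
Implicit Types (f g h H : R -> R) (a b x y c t C q M : R).
Local Notation mu := (@lebesgue_measure R).

Definition expdec a f := exists C, forall x, `|f x| <= C * expR (- a * `|x|).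

Lemma expR_norm_continuous a : continuous (fun x : R => expR (a * `|x|)).
Proof.
move=> x; apply: (@continuous_comp _ _ _ (fun x => a * `|x|) expR).
  by apply: cvgM; [exact: cvg_cst|exact: norm_continuous].
exact: continuous_expR.
Qed.

Lemma expR_norm_L1 a : 0 < a -> L1 (fun x : R => expR (- a * `|x|)).
Proof.
move=> a0.
have i1 : L1 (fun x : R => exponential_pdf a x + exponential_pdf a (- x)).
  apply: L1D; first exact: integrable_exponential_pdf.
  by apply: L1_opp; exact: integrable_exponential_pdf.
apply: (L1_le _ (L1Z a^-1 i1)).
  exact: continuous_meas (@expR_norm_continuous (- a)).
have e0 x : 0 <= exponential_pdf a x by apply: exponential_pdf_ge0; exact: ltW.
move=> x; rewrite (ger0_norm (expR_ge0 _)).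
apply: (le_trans _ (ler_norm _)).
have aux y : 0 <= y -> expR (- a * y) <= a^-1 * (exponential_pdf a y + exponential_pdf a (- y)).
  move=> y0; rewrite [exponential_pdf a y]exponential_pdfE//.
  by rewrite mulrDr mulrA mulVf ?gt_eqF// mul1r lerDl mulr_ge0// invr_ge0 ltW.
case: (ger0P x) => x0; first exact: aux.
by have := aux (- x); rewrite opprK [X in a^-1 * X]addrC; apply; lra.
Qed.

Lemma expdec_L1 a f : 0 < a -> measurable_fun [set: R] f -> expdec a f -> L1 f.
Proof.
move=> a0 mf [C fC]; apply: (L1_le mf (L1Z C (expR_norm_L1 a0))) => x.
exact: le_trans (fC x) (ler_norm _).
Qed.

Lemma expdec_le a f g : (forall x, `|f x| <= `|g x|) -> expdec a g -> expdec a f.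
Proof. by move=> fg [C gC]; exists C => x; exact: le_trans (fg x) (gC x). Qed.

Lemma expdec_shift a c f : 0 <= a -> expdec a f -> expdec a (fun x => f (x + c)).
Proof.
move=> a0 [C fC]; exists (C * expR (a * `|c|)) => x; apply: le_trans (fC _) _.
have C0 : 0 <= C.
  by have := le_trans (normr_ge0 _) (fC 0); rewrite pmulr_lge0// expR_gt0.
rewrite -mulrA -expRD ler_wpM2l// ler_expR.
have : `|x| <= `|x + c| + `|c|.
  by have := ler_normB (x + c) c; rewrite addrK.
by nra.
Qed.

Lemma expdecZ a c f : expdec a f -> expdec a (fun x => c * f x).
Proof.
move=> [C fC]; exists (`|c| * C) => x; rewrite normrM -mulrA.
by rewrite ler_wpM2l.
Qed.

Lemma expdecD a f g : expdec a f -> expdec a g -> expdec a (fun x => f x + g x).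
Proof.
move=> [C fC] [D gD]; exists (C + D) => x; rewrite mulrDl.
by apply: le_trans (ler_normD _ _) _; rewrite lerD.
Qed.

Lemma expdec_nabla a f : 0 <= a -> expdec a f -> expdec a (nabla f).
Proof.
move=> a0 ef; rewrite /nabla.
have h1 := expdec_shift 2^-1 a0 ef.
have h2 := expdecZ (-1) (expdec_shift (- 2^-1) a0 ef).
have := expdecD h1 h2.
by apply: expdec_le => x; rewrite mulN1r.
Qed.

Lemma expdec_bounded_mul a M f p : (forall x, `|p x| <= M) -> expdec a f ->
  expdec a (fun x => p x * f x).
Proof.
move=> pM ef; apply: (@expdec_le a _ (fun x => M * f x)); last exact: expdecZ.
move=> x; rewrite !normrM ler_wpM2r//.
by apply: le_trans (pM x) _; exact: ler_norm.
Qed.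

Lemma expdec_avg a f : 0 <= a -> continuous f -> expdec a f -> expdec a (avg f).
Proof.
move=> a0 cf [C fC]; exists (C * expR a) => x.
have [c cx ->] := avg_mean x cf; apply: le_trans (fC _) _.
have C0 : 0 <= C.
  by have := le_trans (normr_ge0 _) (fC 0); rewrite pmulr_lge0// expR_gt0.
rewrite -mulrA -expRD ler_wpM2l// ler_expR.
have : `|x| <= `|c| + 1.
  have := ler_normB c (c - x); rewrite opprB addrC subrK => h.
  by apply: le_trans h _; rewrite lerD2l; lra.
by nra.
Qed.

Lemma L2_criterion f : measurable_fun [set: R] f -> L1 (fun x => f x ^+ 2) -> L2 f.
Proof.
move=> mf /integrableP[_ ioo]; rewrite /L2 inE; apply/andP; split.
  by rewrite inE.
rewrite inE/= /finite_norm unlock.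
rewrite poweR_lty//.
move: ioo; congr (_ < _)%E; apply: eq_integral => x _ /=.
  by rewrite powR_mulrn// normrX.
Qed.

Lemma expdec_L2 a f : 0 < a -> measurable_fun [set: R] f -> expdec a f -> L2 f.
Proof.
move=> a0 mf ef; apply: L2_criterion => //.
have [C fC] := ef; have i1 := expdec_L1 a0 mf ef.
have : L1 (fun x => f x * f x).
  apply: (@L1M _ C) => // x; apply: le_trans (fC x) _.
  have C0 : 0 <= C.
    by have := le_trans (normr_ge0 _) (fC 0); rewrite pmulr_lge0// expR_gt0.
  rewrite ler_piMr// -expR0 ler_expR mulNr oppr_le0 mulr_ge0//; exact: ltW.
by apply: eq_integrable => // x _ /=; rewrite expr2.
Qed.

Lemma expdec_weighted a f : 0 < a -> expdec (2 * a) f -> expdec a (weighted a f).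
Proof.
move=> a0 [C fC]; exists C => x; rewrite /weighted normrM ger0_norm ?expR_ge0//.
have C0 : 0 <= C.
  by have := le_trans (normr_ge0 _) (fC 0); rewrite pmulr_lge0// expR_gt0.
apply: le_trans (ler_wpM2l (expR_ge0 _) (fC x)) _.
rewrite mulrCA ler_wpM2l// -expRD ler_expR.
have := ler_norm x; nra.
Qed.

(** Compared with the a priori bound exp (a x), every unit step to the right
    gains a factor q exp a <= exp (- 3 a).  About x - b steps are possible, which
    leaves the rate a - 3 a = - 2 a. *)
Lemma decay_right f a b C q : 0 < a -> 0 < b -> q * expR (4 * a) <= 1 -> 0 <= C ->
  (forall x, 0 <= x -> `|f x| <= C * expR (a * x)) ->
  (forall x, b + 1 <= x -> forall M, (forall y, `|y - x| <= 1 -> `|f y| <= M) ->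
     `|f x| <= q * M) ->
  forall x, 0 <= x -> `|f x| <= C * expR (3 * a * (b + 1)) * expR (- (2 * a) * x).
Proof.
move=> a0 b0 q1 C0 fC fq.
have aux (k : nat) : forall x, b + k%:R <= x ->
    `|f x| <= C * expR (a * x - 3 * a * k%:R).
  elim: k => [|k IH] x; first by rewrite mulr0 subr0 addr0 => bx; apply: fC; lra.
  rewrite -natr1 => bx.
  have k0 : 0 <= k%:R :> R by [].
  apply: le_trans (fq x _ (C * expR (a * (x + 1) - 3 * a * k%:R)) _) _.
  - by lra.
  - move=> y; rewrite ler_norml => /andP[y1 y2].
    apply: le_trans (IH y _) _; first by lra.
    by rewrite ler_wpM2l// ler_expR lerD2r ler_pM2l//; lra.
  - rewrite mulrCA ler_wpM2l//.
    have -> : a * (x + 1) - 3 * a * k%:R = 4 * a + (a * x - 3 * a * (k%:R + 1)) by ring.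
    by rewrite expRD mulrA ler_piMl ?expR_ge0.
move=> x x0; rewrite -mulrA -expRD.
have [xb|bx] := leP x b.
  apply: le_trans (fC x x0) _; rewrite ler_wpM2l// ler_expR; nra.
have xb0 : 0 <= x - b by lra.
pose k := Num.truncn (x - b).
have /andP[k1 k2] := Num.Theory.truncn_itv xb0.
rewrite -/k -natr1 in k1 k2.
apply: le_trans (aux k x _) _; first by lra.
rewrite ler_wpM2l// ler_expR; nra.
Qed.

End decay.

(** * Continuously differentiable and unimodal functions *)

Section profile.
Context {R : realType}.
Implicit Types (f g h H : R -> R) (a b x y c t e C q M : R).
Local Notation mu := (@lebesgue_measure R).

Lemma C1_primitive f : C1 f -> primitive (f^`())%classic f.
Proof. by move=> [df _] x; split; [exact: df|rewrite derive1E]. Qed.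

Lemma C1_continuous f : C1 f -> continuous f.
Proof. by move=> /C1_primitive/is_derive_continuous. Qed.

Lemma primitive_derive1 f df : primitive df f -> (f^`())%classic = df.
Proof. by move=> d; apply/funext => x; rewrite derive1E; case: (d x). Qed.

(** Otherwise f would stay above e on a whole half-line. *)
Lemma unimodal_vanish f : continuous f -> (forall x, 0 <= f x) ->
  even_fun f -> unimodal f -> L2 f ->
  forall e, 0 < e -> exists2 M, 0 < M & forall x, M <= `|x| -> f x <= e.
Proof.
move=> cf f0 fe [_ fd] f2 e e0.
apply: contrapT => nM.
have fge y : 0 < y -> e <= f y.
  move=> y0; rewrite leNgt; apply/negP => fy; apply: nM; exists y => // x yx.
  rewrite -(even_norm fe) (le_trans _ (ltW fy))//; exact: fd.
have i2 : L1 (fun x => f x ^+ 2) := Lfun2_integrable_sqr f2.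
have cf2 : continuous (fun x => f x ^+ 2).
  by move=> x; under eq_fun do rewrite expr2; apply: cvgM; exact: cf.
pose I := \int[mu]_x (f x ^+ 2).
have I0 : 0 <= I by apply: Rintegral_ge0 => x _; rewrite sqr_ge0.
(* Over an interval of length T the integral of f^2 would exceed I. *)
pose T := (I + 1) / e ^+ 2.
have T0 : 0 <= T by rewrite divr_ge0 ?sqr_ge0//; lra.
have h1 : \int[mu]_(x in `[1, 1 + T]) (e ^+ 2) <= \int[mu]_(x in `[1, 1 + T]) (f x ^+ 2).
  apply: le_Rintegral => //.
  - by apply: continuous_integrable_cc => x; exact: cvg_cst.
  - exact: continuous_integrable_cc.
  - move=> x /=; rewrite in_itv/= => /andP[x1 _].
    by rewrite lerXn2r ?nnegrE// ?(ltW e0)// fge//; lra.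
have h2 := @Rintegral_cc_le R (fun x => f x ^+ 2) 1 (1 + T) cf2 (fun x => sqr_ge0 _) i2.
have dc : primitive (fun=> e ^+ 2) (fun x : R => e ^+ 2 * x).
  by move=> x; apply: is_derive_eq; rewrite /GRing.scale/= mulr1.
have cc : continuous (fun _ : R => e ^+ 2) by move=> x; exact: cvg_cst.
rewrite (primitive_Rintegral cc dc) in h1; last by lra.
have h3 : e ^+ 2 * (1 + T) - e ^+ 2 * 1 = I + 1.
  rewrite (_ : _ - _ = e ^+ 2 * T); last by ring.
  by rewrite /T mulrC divfK// gt_eqF// exprn_gt0.
by rewrite -/I in h2; lra.
Qed.

Lemma cst_eq0_small c : (forall e, 0 < e -> `|c| <= e) -> c = 0.
Proof.
move=> h; apply/eqP; rewrite -normr_eq0 -[_ == 0]negbK; apply/negP.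
by rewrite neq_lt ltNge normr_ge0/= => c0; have := h (`|c| / 2); lra.
Qed.

End profile.

(** * Averages of locally summable functions *)

Section window.
Context {R : realType}.
Implicit Types (f g h H : R -> R) (a b x y c t e C q M : R).
Local Notation mu := (@lebesgue_measure R).

Definition locint f := measurable_fun [set: R] f /\
  forall a b, mu.-integrable `[a, b] (EFin \o f).

Lemma integrable_restrict f a b :
  mu.-integrable `[a, b] (EFin \o f) <-> L1 (f \_ `[a, b]).
Proof.
rewrite /L1 -restrict_EFin.
have H := @integrable_mkcond _ (measurableTypeR R) R mu `[a, b]%classic (EFin \o f).
by apply: H; exact: measurable_itv.
Qed.

Lemma continuous_locint f : continuous f -> locint f.
Proof.
by move=> cf; split; [exact: continuous_meas|move=> a b; exact: continuous_integrable_cc].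
Qed.

Definition window x y : R := (`|x - y| <= 2^-1)%R%:R.

Lemma window_sym x y : window x y = window y x.
Proof. by rewrite /window distrC. Qed.

Lemma window_ge0 x y : 0 <= window x y.
Proof. exact: ler0n. Qed.

Lemma window_restrict h x :
  (fun y => window x y * h y) = h \_ `[x - 2^-1, x + 2^-1].
Proof.
apply/funext => y; rewrite /window patchE mem_setE in_itv/= distrC.
have -> : (x - 2^-1 <= y <= x + 2^-1) = (`|y - x| <= 2^-1) by rewrite ler_distl.
by case: (_ <= _); rewrite ?mul1r ?mul0r.
Qed.

Lemma avg_window h x : avg h x = \int[mu]_y (window x y * h y).
Proof. by rewrite /avg Rintegral_mkcond window_restrict. Qed.

Lemma window_L1 h x : locint h -> L1 (fun y => window x y * h y).
Proof.
move=> [_ ih]; rewrite window_restrict.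
exact/integrable_restrict.
Qed.

Lemma locint_norm f : locint f -> locint (fun x => `|f x|).
Proof.
move=> [mf intf]; split; first exact: measurableT_comp.
move=> a b; have /integrableP[mm ii] := intf a b.
apply/integrableP; split.
  apply/measurable_EFinP/measurable_funTS; exact: measurableT_comp.
by move: ii; congr (_ < _)%E; apply: eq_integral => x _ /=; rewrite normr_id.
Qed.

Lemma locintB f g : locint f -> locint g -> locint (fun x => f x - g x).
Proof.
move=> [mf intf] [mg ig]; split; first exact: measurable_funB.
move=> a b; have H := fun mD => integrableB mD (intf a b) (ig a b).
by apply: H; exact: measurable_itv.
Qed.

Lemma locint_shift c f : locint f -> locint (fun x => f (x + c)).
Proof.
move=> [mf intf]; split; first by apply: measurableT_comp => //; case: (preserves_shift c).
move=> a b; apply/integrable_restrict.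
have /integrable_restrict/L1_shift-/(_ c) := intf (a + c) (b + c).
apply: eq_integrable => // x _ /=; rewrite !patchE !mem_setE !in_itv/=.
by rewrite !lerD2r.
Qed.

Lemma locint_loc f : locint f -> locally_integrable [set: R] f.
Proof.
move=> [mf intf]; split => //; first exact: openT.
move=> K _ cK; have [M [_ KM]] := compact_bounded cK.
have sK : K `<=` `[- (M + 1), M + 1].
  move=> x Kx /=; rewrite in_itv/= -ler_norml.
  by apply: (KM (M + 1)) => //; rewrite ltrDl.
have /integrableP[_ ii] := intf (- (M + 1)) (M + 1).
apply: le_lt_trans ii; apply: ge0_subset_integral => //.
  exact: compact_measurable.
apply/measurable_EFinP/measurable_funTS; exact: measurableT_comp.
Qed.

Lemma loc_locint f : locally_integrable [set: R] f -> locint f.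
Proof.
move=> [mf _ intf]; split => // a b; apply/integrableP; split.
  by apply/measurable_EFinP; exact: measurable_funTS.
by apply: intf => //; exact: segment_compact.
Qed.

Lemma window_meas : measurable_fun [set: R * R] (fun z => window z.1 z.2).
Proof.
pose A : set (R * R) := [set z | `|z.1 - z.2| <= 2^-1].
have mA : measurable A.
  have m1 : measurable_fun [set: R * R] (fun z : R * R => `|z.1 - z.2|).
    apply: measurableT_comp => //.
    by apply: measurable_funB; [exact: measurable_fst|exact: measurable_snd].
  have -> : A = (fun z : R * R => `|z.1 - z.2|) @^-1` `]-oo, 2^-1].
    by apply/seteqP; split => z /=; rewrite /A/= in_itv.
  by rewrite -[X in measurable X]setTI; apply: m1 => //; exact: measurable_itv.
have := @measurable_indic _ _ R setT A mA.
congr measurable_fun; apply/funext => z.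
by rewrite indicE /A /window mem_setE.
Qed.

(** Fubini's theorem for the symmetric kernel [window]; the last hypothesis is
    the absolute convergence of the double integral. *)
Lemma avg_adjoint f h : locint f -> locint h ->
  L1 (fun x => `|f x| * avg (fun y => `|h y|) x) ->
  \int[mu]_x (f x * avg h x) = \int[mu]_x (h x * avg f x).
Proof.
move=> lf lh i1; have [mf intf] := lf; have [mh inth] := lh.
pose F (z : R * R) := (f z.1 * (window z.1 z.2 * h z.2))%:E.
have mF : measurable_fun [set: R * R] F.
  apply/measurable_EFinP; apply: measurable_funM.
    by apply: measurableT_comp mf _; exact: measurable_fst.
  apply: measurable_funM; first exact: window_meas.
  by apply: measurableT_comp mh _; exact: measurable_snd.
have iF : (mu \x mu)%E.-integrable [set: R * R] F.
  apply/integrable12ltyP => //.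
  have -> : (\int[mu]_x \int[mu]_y `|F (x, y)| =
             \int[mu]_x (`|f x| * avg (fun y => `|h y|) x)%:E)%E.
    apply: eq_integral => x _.
    have lh' := locint_norm lh.
    rewrite EFinM avg_window -Rintegral_EFin; last exact: window_L1.
    rewrite -ge0_integralZl//; last 2 first.
      by apply/measurable_EFinP; exact: (L1_meas (window_L1 x lh')).
      by move=> y _; rewrite lee_fin mulr_ge0// window_ge0.
    apply: eq_integral => y _; rewrite /F /= -EFinM !normrM.
    by rewrite (ger0_norm (window_ge0 _ _)).
  by rewrite Rintegral_EFin// ltry.
rewrite /Rintegral; congr fine.
have E1 x : (\int[mu]_y F (x, y) = (f x * avg h x)%:E)%E.
  rewrite avg_window EFinM -Rintegral_EFin; last exact: window_L1.
  rewrite -integralZl//; last exact: window_L1.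
have E2 y : (\int[mu]_x F (x, y) = (h y * avg f y)%:E)%E.
  rewrite avg_window EFinM -Rintegral_EFin; last exact: window_L1.
  rewrite -integralZl//; last exact: window_L1.
  apply: eq_integral => x _; rewrite /F /= -EFinM (window_sym y); congr EFin; ring.
under eq_integral do rewrite -E1.
under [RHS]eq_integral do rewrite -E2.
exact: Fubini.
Qed.

End window.

(** * Fast solitary waves *)

Section fast_waves.
Context {R : realType}.
Implicit Types (f g h H : R -> R) (a b x y c t e C q M : R).
Local Notation mu := (@lebesgue_measure R).

Section wave.
Context (m sigma d : R) (r v : R -> R).

Definition solitary_wave := [/\ 0 < sigma /\ travelling_wave m sigma r v,
  [/\ L2 v, BC1 v, (forall x, 0 <= v x), even_fun v & unimodal v],
  [/\ L2 r, BC1 r, (forall x, 0 <= r x), even_fun r & unimodal r],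
  ('N[lebesgue_measure]_2%:E[EFin \o v] = (1 - d)%:E)%E &
  (forall x, 0 <= r x < 1)].

Context (m_gt1 : 1 < m) (d01 : 0 < d < 1) (sw : solitary_wave).

Let s0 : 0 < sigma. Proof. by case: sw => -[]. Qed.
Let tw : travelling_wave m sigma r v. Proof. by case: sw => -[]. Qed.
Let v2 : L2 v. Proof. by case: sw => _ []. Qed.
Let v0 x : 0 <= v x. Proof. by case: sw => _ [_ _ + _ _]. Qed.
Let ve : even_fun v. Proof. by case: sw => _ []. Qed.
Let vu : unimodal v. Proof. by case: sw => _ []. Qed.
Let r2 : L2 r. Proof. by case: sw => _ _ []. Qed.
Let rb : BC1 r. Proof. by case: sw => _ _ []. Qed.
Let re : even_fun r. Proof. by case: sw => _ _ []. Qed.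
Let ru : unimodal r. Proof. by case: sw => _ _ []. Qed.
Let nv : ('N[lebesgue_measure]_2%:E[EFin \o v] = (1 - d)%:E)%E.
Proof. by case: sw. Qed.
Let r01 x : 0 <= r x < 1. Proof. by case: sw. Qed.
Let r_ge0 x : 0 <= r x. Proof. by case/andP: (r01 x). Qed.
Let r_lt1 x : r x < 1. Proof. by case/andP: (r01 x). Qed.

Definition dr := (r^`())%classic.
Definition dv := (v^`())%classic.
(** With [stiffness] below: Phi'(r) / sigma is the nonlinearity of the wave
    equations and Phi''(r) / sigma the coefficient of their linearisation. *)
Definition force x := dPhi m (r x) / sigma.
Definition stiffness x := sigma^-1 * d2Phi m (r x).

Let r_C1 : C1 r. Proof. by case: tw. Qed.
Let v_C1 : C1 v. Proof. by case: tw. Qed.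
Lemma r_cont : continuous r. Proof. exact: C1_continuous. Qed.
Lemma v_cont : continuous v. Proof. exact: C1_continuous. Qed.
Lemma dr_cont : continuous dr. Proof. by case: r_C1. Qed.
Lemma dv_cont : continuous dv. Proof. by case: v_C1. Qed.

Lemma drE x : dr x = nabla v x. Proof. by case: tw. Qed.

Lemma dvE x : dv x = nabla force x.
Proof.
case: tw => _ _ r1 _ /(_ x) H.
rewrite /dv -[LHS](mulKf (lt0r_neq0 s0)) H /nabla /force /= !derive1_Phi// mulrC mulrBl.
by [].
Qed.

Lemma is_derive_comp_r (f df : R -> R) x :
  (forall y, y < 1 -> is_derive y 1 f (df y)) ->
  is_derive x 1 (fun y => f (r y)) (df (r x) * dr x).
Proof.
move=> H; apply: (@is_derive1_comp R f r x); first exact: H.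
by have := C1_primitive r_C1 x.
Qed.

Lemma force_derive : primitive (fun x => stiffness x * dr x) force.
Proof.
move=> x; have d1 := is_derive_comp_r x (is_derive_dPhi m_gt1).
rewrite /force; have -> : (fun x => dPhi m (r x) / sigma) = (fun x => sigma^-1 * dPhi m (r x)).
  by apply/funext => y; rewrite mulrC.
apply: is_derive_eq.
by rewrite /GRing.scale/= /stiffness mulrA.
Qed.

Lemma force_cont : continuous force.
Proof. exact: is_derive_continuous force_derive. Qed.

Lemma stiffness_cont : continuous stiffness.
Proof.
move=> x; apply: cvgM; first exact: cvg_cst.
by apply: (@continuous_comp _ _ _ r (d2Phi m)); [exact: r_cont|exact: continuous_d2Phi].
Qed.

Lemma stiffness_gt0 x : 0 < stiffness x.
Proof. by rewrite mulr_gt0 ?invr_gt0// d2Phi_gt0. Qed.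

Lemma r_le0 x : r x <= r 0.
Proof.
rewrite -(even_norm re x); rewrite leNgt; apply/negP => h.
have x0 : 0 < `|x|.
  by rewrite normr_gt0; apply/negP => /eqP xE; move: h; rewrite xE normr0 ltxx.
have /cvgrPdist_lt/(_ (r `|x| - r 0)) := r_cont (x := 0).
rewrite subr_gt0 => /(_ h) [e /= e0 He].
pose y := Num.min (e / 2) `|x|.
have y0 : 0 < y by rewrite lt_min divr_gt0.
have := He y; rewrite /= sub0r normrN gtr0_norm// => /(_ _).
have ye : y < e by rewrite gt_min; apply/orP; left; lra.
have ryx : r `|x| <= r y by case: ru => _; apply => //; rewrite ge_min lexx orbT.
move=> /(_ ye); rewrite ltr_norml => /andP[]; lra.
Qed.

Lemma stiffness_le x : stiffness x <= stiffness 0.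
Proof.
by rewrite ler_wpM2l ?invr_ge0 ?(ltW s0)// d2Phi_le// r_le0.
Qed.

Lemma stiffness_even x : stiffness (- x) = stiffness x.
Proof. by rewrite /stiffness re. Qed.

Lemma force_ge0 x : 0 <= force x.
Proof. by rewrite divr_ge0 ?(ltW s0)// dPhi_ge0. Qed.

Lemma force_even x : force (- x) = force x.
Proof. by rewrite /force re. Qed.

Lemma force_le x : force x <= stiffness x * r x.
Proof.
by rewrite /force /stiffness mulrC -mulrA ler_wpM2l ?invr_ge0 ?(ltW s0)// dPhi_le_mul.
Qed.

Lemma force_lt x : 0 < r x -> force x < stiffness x * r x.
Proof.
by move=> r0; rewrite /force /stiffness mulrC -mulrA ltr_pM2l ?invr_gt0// dPhi_lt.
Qed.

Lemma r_vanish e : 0 < e -> exists2 M, 0 < M & forall x, M <= `|x| -> r x <= e.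
Proof. exact: (unimodal_vanish r_cont). Qed.

Lemma v_vanish e : 0 < e -> exists2 M, 0 < M & forall x, M <= `|x| -> v x <= e.
Proof. exact: (unimodal_vanish v_cont). Qed.

(** The two sides have the same derivative and both tend to 0. *)
Lemma avg_unique f h : (forall x, 0 <= h x) -> (forall x, 0 <= f x) -> continuous h ->
  primitive (nabla h) f ->
  (forall e, 0 < e -> exists2 M, 0 < M & forall x, M <= `|x| -> f x <= e) ->
  (forall e, 0 < e -> exists2 M, 0 < M & forall x, M <= `|x| -> h x <= e) ->
  forall x, f x = avg h x.
Proof.
move=> h0 f0 ch df fv hv.
have [c cE] := primitive_unique (avg_derive ch) df.
suff c0 : c = 0 by move=> x; rewrite cE c0 addr0.
apply: cst_eq0_small => e e0.
have [M M0 fM] := fv e e0; have [M' M'0 hM'] := hv e e0.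
have := cE (M + M' + 1).
have [z zx ->] := avg_mean (M + M' + 1) ch.
have f1 : f (M + M' + 1) <= e by apply: fM; rewrite ger0_norm; lra.
have h1 : h z <= e.
  apply: hM'; move: zx; rewrite ltr_norml => /andP[? ?].
  by rewrite ger0_norm; lra.
have := f0 (M + M' + 1); have := h0 z => h2 f2 E.
by rewrite ler_norml; apply/andP; split; lra.
Qed.

Lemma r_avg x : r x = avg v x.
Proof.
apply: avg_unique => //; [exact: v_cont| |exact: r_vanish|exact: v_vanish].
by move=> y; have := C1_primitive r_C1 y; rewrite -/dr drE.
Qed.

Lemma force_vanish e : 0 < e -> exists2 M, 0 < M & forall x, M <= `|x| -> force x <= e.
Proof.
move=> e0.
have s00 := stiffness_gt0 0.
have [M M0 rM] := r_vanish (divr_gt0 e0 s00).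
exists M => // x Mx; apply: le_trans (force_le x) _.
rewrite (@le_trans _ _ (stiffness 0 * r x))//; first by rewrite ler_wpM2r// stiffness_le.
by have := rM x Mx; rewrite ler_pdivlMr// mulrC.
Qed.

Lemma v_avg x : v x = avg force x.
Proof.
apply: avg_unique => //; [exact: force_ge0|exact: force_cont| |exact: v_vanish|exact: force_vanish].
by move=> y; have := C1_primitive v_C1 y; rewrite -/dv dvE.
Qed.

Lemma dv_avg x : dv x = avg (fun y => stiffness y * dr y) x.
Proof.
rewrite dvE (primitive_avg _ _ force_derive)//.
by move=> y; apply: cvgM; [exact: stiffness_cont|exact: dr_cont].
Qed.

Lemma dr_avg x : dr x = avg dv x.
Proof. by rewrite drE (primitive_avg _ dv_cont (C1_primitive v_C1)). Qed.

Lemma stiffness_dr_cont : continuous (fun y => stiffness y * dr y).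
Proof. by move=> y; apply: cvgM; [exact: stiffness_cont|exact: dr_cont]. Qed.

Lemma dr_conv x : dr x = tent_conv (fun y => stiffness y * dr y) x.
Proof.
rewrite dr_avg /tent_conv -avg_avg_tent_conv; last exact: stiffness_dr_cont.
by congr avg; apply/funext => y; exact: dv_avg.
Qed.

Lemma r_conv x : r x = tent_conv force x.
Proof.
rewrite r_avg /tent_conv -avg_avg_tent_conv; last exact: force_cont.
by congr avg; apply/funext => y; exact: v_avg.
Qed.

Lemma dr_odd x : dr (- x) = - dr x.
Proof.
rewrite !drE /nabla opprB; congr (_ - _); rewrite -ve; congr v; ring.
Qed.

Lemma r_gt0_ex : exists x, r x != 0.
Proof.
apply: contrapT => nr.
have rz x : r x = 0.
  by apply/eqP/negPn/negP => h; apply: nr; exists x.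
have fz x : force x = 0 by rewrite /force rz dPhi0 mul0r.
have vz : v = cst 0.
  apply/funext => x /=; rewrite v_avg.
  by have [c _ ->] := avg_mean x force_cont.
move: nv; rewrite vz; have -> : EFin \o cst (0:R) = cst 0%E by [].
by rewrite Lnorm0//; case; case/andP: d01; lra.
Qed.

Lemma dr_le0 x : 0 < x -> dr x <= 0.
Proof.
move=> x0; rewrite leNgt; apply/negP => dx.
have /cvgrPdist_lt/(_ (dr x) dx) [e /= e0 He] := dr_cont (x := x).
have xy : x < x + e / 2 by rewrite ltrDl divr_gt0.
have [|||c] := @MVT R r dr x (x + e / 2).
- by [].
- by move=> y _; exact: C1_primitive r_C1 y.
- exact/continuous_subspaceT/r_cont.
rewrite in_itv/= => /andP[c1 c2] E.
have : r (x + e / 2) <= r x by case: ru => _; apply => //; exact: ltW.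
have := He c; rewrite /= ltr_norml => H.
have : - dr x < dr x - dr c < dr x.
  by rewrite -ltr_norml; apply: He => /=; rewrite ltr_norml; apply/andP; split; lra.
move=> /andP[_ h]; rewrite leNgt => /negP; apply.
by rewrite -subr_gt0 E mulr_gt0//; lra.
Qed.

Lemma int_v2 : \int[mu]_x (v x * v x) <= 1.
Proof.
have := @powR_Lnorm _ _ R mu (EFin \o v) 2%:R.
rewrite nv => /(_ _); rewrite pnatr_eq0 => /(_ isT) E.
have E2 : (\int[mu]_x (v x * v x)%:E = ((1 - d) `^ 2%:R)%:E)%E.
  rewrite [RHS]E; apply: eq_integral => x _ /=.
  by rewrite powR_mulrn// ger0_norm// expr2.
rewrite /Rintegral E2 /= powR_mulrn; last by case/andP: d01; lra.
by case/andP: d01 => ? ?; rewrite expr_le1//; lra.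
Qed.

(** As r = avg v and v = avg force, the integral of force r equals that of v^2,
    which is at most 1; and Phi r <= r Phi'(r) = sigma r force.  Hence the speed
    tends to infinity together with the potential energy. *)
Lemma energy_le : (\int[mu]_x (Phi m (r x))%:E <= sigma%:E)%E.
Proof.
have ir2 : L1 (fun x => r x * r x).
  by have := Lfun2_integrable_sqr r2; apply: eq_integrable => // x _ /=; rewrite expr2.
have iv2 : L1 (fun x => v x * v x).
  by have := Lfun2_integrable_sqr v2; apply: eq_integrable => // x _ /=; rewrite expr2.
have ifr : L1 (fun x => force x * r x).
  apply: (L1_le _ (L1Z (stiffness 0) ir2)).
    by apply: measurable_funM; apply: continuous_meas; [exact: force_cont|exact: r_cont].
  move=> x; rewrite ger0_norm; last by apply: mulr_ge0; [exact: force_ge0|].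
  apply: (le_trans _ (ler_norm _)).
  rewrite mulrA ler_wpM2r//; apply: le_trans (force_le x) _.
  by rewrite ler_wpM2r// stiffness_le.
have absE f : (forall x, 0 <= f x) -> (fun x => `|f x|) = f.
  by move=> f0; apply/funext => z; rewrite ger0_norm.
have rA := r_avg.
have vA := v_avg.
have E : \int[mu]_x (force x * r x) = \int[mu]_x (v x * v x).
  transitivity (\int[mu]_x (force x * avg v x)).
    by apply: eq_Rintegral => x _; rewrite rA.
  rewrite avg_adjoint; [|exact: (continuous_locint force_cont)|exact: (continuous_locint v_cont)|].
    by apply: eq_Rintegral => x _; rewrite -vA.
  rewrite (absE v)//; apply: eq_integrable ifr => // x _ /=.
  by rewrite (ger0_norm (force_ge0 x)) rA.
have iZ : L1 (fun x => sigma * (force x * r x)) by exact: L1Z.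
apply: (@le_trans _ _ (\int[mu]_x (sigma * (force x * r x))%:E)%E).
  apply: ge0_le_integral => //.
  - by move=> x _; rewrite lee_fin Phi_ge0.
  - apply/measurable_EFinP; apply: (@continuous_meas R (fun x => Phi m (r x))) => x.
    apply: (@continuous_comp _ _ _ r (Phi m)); first exact: r_cont.
    exact: is_derive_cont (is_derive_Phi m_gt1 (r_lt1 x)).
  - by apply/measurable_EFinP; exact: (L1_meas iZ).
  - move=> x _; rewrite lee_fin /force mulrA mulrCA mulfV ?gt_eqF// mulr1 mulrC.
    exact: Phi_le.
rewrite Rintegral_EFin// RintegralZl// lee_fin E.
by rewrite ler_piMr ?int_v2// ltW.
Qed.

Context (a : R) (a0 : 0 < a) (sa : 2 * expR (4 * a) <= sigma).

Lemma stiffness_far : exists2 b, 0 < b &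
  forall x, b <= `|x| -> stiffness x <= 2 / sigma.
Proof.
have [e /andP[e0 e1] He] := d2Phi_small m_gt1.
have [b b0 Hb] := r_vanish e0.
exists b => // x bx; rewrite /stiffness mulrC ler_wpM2r ?invr_ge0 ?(ltW s0)//.
exact/He/Hb.
Qed.

Lemma rate_small : 2 / sigma * expR (4 * a) <= 1.
Proof. by rewrite mulrAC ler_pdivrMr// mul1r. Qed.

Lemma avg_avg_mean f x : continuous f ->
  exists2 c, `|c - x| <= 1 & avg (avg f) x = f c.
Proof.
move=> cf; have [c cx ->] := avg_mean x (avg_continuous cf).
have [c' cx' ->] := avg_mean c cf; exists c' => //.
move: cx cx'; rewrite !ltr_norml ler_norml => /andP[? ?] /andP[? ?].
by apply/andP; split; lra.
Qed.

(** An average of averages is a value at distance at most one, so that in the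
    region where the stiffness is below 2 / sigma the values of f contract. *)
Lemma tail_decay f C : 0 <= C -> (forall x, 0 <= x -> `|f x| <= C * expR (a * x)) ->
  (forall x, exists2 c, `|c - x| <= 1 & `|f x| <= stiffness c * `|f c|) ->
  exists D, forall x, 0 <= x -> `|f x| <= D * expR (- (2 * a) * x).
Proof.
move=> C0 fC fs; have [b b0 sb] := stiffness_far.
exists (C * expR (3 * a * (b + 1))).
apply: (decay_right a0 b0 rate_small C0 fC) => x bx M fM.
have [c cx fc] := fs x; apply: le_trans fc _.
apply: ler_pM => //; first exact/ltW/stiffness_gt0.
  apply: sb; move: cx; rewrite ler_norml => /andP[? ?].
  by rewrite ger0_norm; lra.
exact: fM.
Qed.

Lemma tail_decay_even f C : 0 <= C -> (forall x, `|f (- x)| = `|f x|) ->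
  (forall x, 0 <= x -> `|f x| <= C * expR (a * x)) ->
  (forall x, exists2 c, `|c - x| <= 1 & `|f x| <= stiffness c * `|f c|) ->
  expdec (2 * a) f.
Proof.
move=> C0 fe fC fs; have [D HD] := tail_decay C0 fC fs; exists D => x.
by case: (ger0P x) => x0; [exact: HD|rewrite -fe; apply: HD; lra].
Qed.

Lemma r_dec : expdec (2 * a) r.
Proof.
apply: (@tail_decay_even _ 1) => //.
- by move=> x; rewrite re.
- move=> x x0; rewrite mul1r ger0_norm//; apply: le_trans (ltW (r_lt1 x)) _.
  by rewrite -expR0 ler_expR mulr_ge0// ltW.
- move=> x.
  have -> : r x = avg (avg force) x.
    rewrite r_avg; congr avg; apply/funext => y.
    exact: v_avg.
  have [c cx ->] := avg_avg_mean x force_cont; exists c => //.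
  by rewrite (ger0_norm (force_ge0 c)) ger0_norm ?force_le.
Qed.

Lemma bounded_ex f : bounded_fun f -> exists2 M, 0 <= M & forall x, `|f x| <= M.
Proof.
move=> [M [_ HM]]; exists (`|M| + 1); first by rewrite addr_ge0.
by move=> x; apply: (HM (`|M| + 1)) => //; have := ler_norm M; lra.
Qed.

Lemma dr_dec : expdec (2 * a) dr.
Proof.
have [M M0 HM] : exists2 M, 0 <= M & forall x, `|dr x| <= M.
  by apply: bounded_ex; case: rb.
apply: (@tail_decay_even _ M) => //.
- by move=> x; rewrite dr_odd normrN.
- move=> x x0; apply: le_trans (HM x) _.
  by rewrite ler_peMr// -expR0 ler_expR mulr_ge0// ltW.
- move=> x.
  have -> : dr x = avg (avg (fun y => stiffness y * dr y)) x.
    rewrite dr_avg; congr avg; apply/funext => y.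
    exact: dv_avg.
  have [c cx ->] := avg_avg_mean x stiffness_dr_cont.
  by exists c => //; rewrite normrM (ger0_norm (ltW (stiffness_gt0 _))).
Qed.

Lemma stiffness_norm x : `|stiffness x| <= stiffness 0.
Proof. by rewrite (ger0_norm (ltW (stiffness_gt0 x))) stiffness_le. Qed.

Lemma stiffness_dr_dec : expdec (2 * a) (fun x => stiffness x * dr x).
Proof. exact: expdec_bounded_mul stiffness_norm dr_dec. Qed.

Lemma dv_dec : expdec (2 * a) dv.
Proof.
have a20 : 0 <= 2 * a by rewrite mulr_ge0// ltW.
have := expdec_avg a20 stiffness_dr_cont stiffness_dr_dec.
by apply: expdec_le => x; rewrite -dv_avg.
Qed.

Let a20 : 0 < 2 * a. Proof. by rewrite mulr_gt0. Qed.

Lemma dr_L1 : L1 dr.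
Proof. by apply: (expdec_L1 a20 _ dr_dec); exact: continuous_meas dr_cont. Qed.

Lemma force_L1 : L1 force.
Proof.
apply: (expdec_L1 a20); first exact: continuous_meas force_cont.
apply: (@expdec_le _ _ _ (fun x => stiffness 0 * r x)).
  move=> x; rewrite (ger0_norm (force_ge0 x)); apply: (le_trans _ (ler_norm _)).
  by apply: le_trans (force_le x) _; rewrite ler_wpM2r// stiffness_le.
by apply: expdecZ; exact: r_dec.
Qed.

Lemma slope_conv x : - dr x = tent_conv (fun y => stiffness y * - dr y) x.
Proof.
rewrite dr_conv -mulN1r -tent_convZ.
  by congr tent_conv; apply/funext => y; ring.
exact: (coef_L1 stiffness_cont stiffness_gt0 stiffness_le dr_L1).
Qed.

(** A zero of the slope would spread to the whole line; then r would be constant,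
    hence zero, and so would v. *)
Lemma slope_gt0 x : 0 < x -> 0 < - dr x.
Proof.
move=> x0; rewrite lt0r; apply/andP; split; last first.
  by rewrite oppr_ge0; exact: dr_le0.
apply/negP => /eqP drx.
pose h x := - dr `|x|.
have dr0 : dr 0 = 0 by have := dr_odd 0; rewrite oppr0; lra.
have h0 y : 0 <= h y.
  rewrite oppr_ge0; have [->|y0] := eqVneq y 0; first by rewrite normr0 dr0.
  by apply: dr_le0; rewrite normr_gt0.
have ch : continuous h.
  move=> y; apply: cvgN; apply: (@continuous_comp _ _ _ (fun x => `|x|) dr).
    exact: norm_continuous.
  exact: dr_cont.
have eh y : h `|y| = h y by rewrite /h normr_id.
have ih : L1 h.
  apply: (L1_le _ dr_L1); first exact: continuous_meas.
  by move=> y; rewrite /h normrN; case: (ger0P y) => // _; rewrite dr_odd normrN.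
have hK y : h y = fold_op odd_kernel (fun z => stiffness z * h z) y.
  have iN : L1 (fun z => stiffness z * - dr z).
    apply: (coef_L1 stiffness_cont stiffness_gt0 stiffness_le).
    by have := L1Z (-1) dr_L1; apply: eq_integrable => // z _ /=; rewrite mulN1r.
  have oN z : stiffness (- z) * - dr (- z) = - (stiffness z * - dr z).
    by rewrite stiffness_even dr_odd mulrN.
  apply: etrans (slope_conv `|y|) _.
  apply: etrans (@tent_conv_odd R (fun z => stiffness z * - dr z) y iN oN) _.
  apply: (congr1 (fun F => fold_op odd_kernel F y)); apply/funext => z.
  by rewrite (even_norm stiffness_even).
have hx : h x = 0 by rewrite /h gtr0_norm.
have hz := odd_solution_positivity stiffness_cont stiffness_gt0 stiffness_le ch ih h0 eh
  (fun y _ => hK y) (lt0r_neq0 x0) hx.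
have drz y : dr y = 0.
  have := hz y; rewrite /h; case: (ger0P y) => y0; rewrite ?dr_odd; lra.
have rcst y z : r y = r z.
  apply: (@primitive_cst R) => w; rewrite -(drz w).
  by apply: C1_primitive; case: tw.
have [y /negP] := r_gt0_ex.
apply; apply/eqP/cst_eq0_small => e e0.
have [M M0 HM] := r_vanish e0.
by rewrite ger0_norm// (rcst y M); apply: HM; exact: ler_norm.
Qed.

Lemma r_gt0 x : 0 < r x.
Proof.
rewrite lt0r r_ge0 andbT; apply/negP => /eqP rx.
have rax : r `|x| = 0 by rewrite (even_norm re).
have [|||c] := @MVT R r dr (`|x|) (`|x| + 1).
- by rewrite ltrDl.
- by move=> y _; apply: C1_primitive; case: tw.
- exact/continuous_subspaceT/r_cont.
rewrite in_itv/= => /andP[c1 c2].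
have c0 : 0 < c by exact: le_lt_trans (normr_ge0 x) c1.
have := slope_gt0 c0; have := r_ge0 (`|x| + 1); rewrite rax; lra.
Qed.

(** The a priori bound permits growth at -oo.  Since the wave is fast compared
    with the weight, [tail_decay] turns it into decay, which makes S summable. *)
Theorem continuous_solutions (S : R -> R) C : continuous S -> 
  (forall x, S x = avg (avg (fun y => stiffness y * S y)) x) ->
  (forall x, `|S x| <= C * expR (- a * x)) ->
  exists c, forall x, S x = c * dr x.
Proof.
move=> cS SA SC.
have C0 : 0 <= C.
  by have := le_trans (normr_ge0 _) (SC 0); rewrite pmulr_lge0// expR_gt0.
have cpS := coef_continuous stiffness_cont cS.
have [D HD] : exists D, forall x, 0 <= x -> `|S (- x)| <= D * expR (- (2 * a) * x).
  apply: (@tail_decay (fun x => S (- x)) C) => //.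
    by move=> x _; apply: le_trans (SC (- x)) _; rewrite mulrNN.
  move=> x; rewrite SA.
  have [c cx ->] := avg_avg_mean (- x) cpS.
  exists (- c); first by rewrite (_ : - c - x = - (c - - x)) ?normrN//; ring.
  by rewrite normrM opprK stiffness_even (ger0_norm (ltW (stiffness_gt0 _))).
have iS : L1 S.
  apply: (expdec_L1 a0); first exact: continuous_meas.
  exists (C + D) => x.
  have D0 : 0 <= D.
    by have := le_trans (normr_ge0 _) (HD 0 (lexx 0)); rewrite pmulr_lge0// expR_gt0.
  have [x0|x0] := leP 0 x.
    rewrite (ger0_norm x0); apply: le_trans (SC x) _.
    by rewrite ler_wpM2r ?expR_ge0//; lra.
  rewrite (ltr0_norm x0); rewrite -{1}[x]opprK.
  apply: le_trans (HD (- x) _) _; first by lra.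
  rewrite ler_pM ?expR_ge0//; first by lra.
  rewrite ler_expR; have : a * x <= 0 by rewrite mulr_ge0_le0// ltW.
  by lra.
have SK x : S x = tent_conv (fun y => stiffness y * S y) x.
  by rewrite SA avg_avg_tent_conv.
have idr : L1 (fun x => - dr x).
  by have := L1Z (-1) dr_L1; apply: eq_integrable => // z _ /=; rewrite mulN1r.
have [c Hc] := tent_conv_solutions stiffness_cont stiffness_gt0 stiffness_le
  stiffness_even
  (w := fun x => - dr x) (fun x => cvgN (dr_cont (x := x))) idr
  (fun x => congr1 -%R (dr_odd x)) slope_gt0 slope_conv
  r_cont r_gt0 force_cont force_L1 force_ge0 force_even
  r_conv
  (fun x => force_lt (r_gt0 x)) cS iS SK.
by exists (- c) => x; rewrite Hc; ring.
Qed.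

End wave.
End fast_waves.

(** * Smooth functions with compact support *)

Section smooth.
Context {R : realType}.
Implicit Types (f g h H : R -> R) (a b x y c t e C q M : R) (n j : nat).
Local Notation mu := (@lebesgue_measure R).

(** The derivative is given explicitly, so that closure under sums and products
    follows by plain induction. *)
Fixpoint Ck n f : Prop :=
  if n is n'.+1 then exists2 df, primitive df f & Ck n' df else True.

Definition smooth f := forall n, Ck n f.

Lemma CkS n f : Ck n.+1 f -> Ck n f.
Proof.
elim: n f => [//|n IH] f [df d Cdf]; exists df => //.
exact: IH.
Qed.

Lemma CkD n f g : Ck n f -> Ck n g -> Ck n (fun x => f x + g x).
Proof.
elim: n f g => [//|n IH] f g [df d Cf] [dg d' Cg].
by exists (fun x => df x + dg x); [move=> x; exact: is_deriveD|exact: IH].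
Qed.

Lemma CkM n f g : Ck n f -> Ck n g -> Ck n (fun x => f x * g x).
Proof.
elim: n f g => [//|n IH] f g Cf Cg.
have [df d Cdf] := Cf; have [dg d' Cdg] := Cg.
exists (fun x => df x * g x + f x * dg x).
  move=> x; have h1 := d x; have h2 := d' x; apply: is_derive_eq.
  by rewrite /GRing.scale/=; ring.
by apply: CkD; apply: IH => //; exact: CkS.
Qed.

Lemma Ck_cst n c : Ck n (fun=> c).
Proof.
by elim: n c => [//|n IH] c; exists (fun=> 0) => // x; exact: is_derive_cst.
Qed.

Lemma Ck_affine n f c b : Ck n f -> Ck n (fun x => f (c * x + b)).
Proof.
elim: n f => [//|n IH] f [df d Cdf].
exists (fun x => df (c * x + b) * c).
  move=> x.
  have dg : is_derive x 1 (fun x : R => c * x + b) c.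
    by apply: is_derive_eq; rewrite /GRing.scale/= mulr1 addr0.
  exact: (@is_derive1_comp R f (fun x => c * x + b) x _ _ (d _) dg).
by apply: CkM; [exact: IH|exact: Ck_cst].
Qed.

Lemma Ck_derive1n n f : Ck n.+1 f -> forall x, derivable (f^`(n))%classic x 1.
Proof.
elim: n f => [|n IH] f [df d Cdf] x; first by rewrite derive1n0; case: (d x).
have -> : (f^`(n.+1))%classic = (df^`(n))%classic.
  by rewrite /derive1n iterSr -/(derive1n _ _) (primitive_derive1 d).
exact: IH.
Qed.

Lemma smooth_continuous f : smooth f -> continuous f.
Proof. by move=> /(_ 1%N) [df d _]; exact: is_derive_continuous d. Qed.

Lemma smooth_test f M : smooth f -> (forall x, M < `|x| -> f x = 0) ->
  test_function f.
Proof.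
move=> sf f0; split; first by move=> n x; exact: (Ck_derive1n (sf n.+1)).
apply: (@subclosed_compact _ _ `[- M, M]).
- exact: closed_closure.
- exact: segment_compact.
- have cE : `[- M, M]%classic = closure `[- M, M]%classic.
    by apply/closure_id; exact: itv_closed.
  rewrite cE.
  apply: closure_subset => x /= /eqP fx; rewrite in_itv/= -ler_norml leNgt.
  by apply/negP => /f0.
Qed.

(** The functions x^(-j) exp (-1/x), extended by zero: a family whose span is
    closed under differentiation. *)
Definition flat j x : R := if 0 < x then x^-1 ^+ j * expR (- x^-1) else 0.

Lemma flat_ge0 j x : 0 <= flat j x.
Proof.
by rewrite /flat; case: ifP => // x0; rewrite mulr_ge0 ?expR_ge0// exprn_ge0// invr_ge0 ltW.
Qed.

(** exp y >= y^(j+1) / (j+1)! with y = 1/x. *)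
Lemma flat_le j x : 0 <= x -> flat j x <= j.+1`!%:R * x.
Proof.
move=> x0; rewrite /flat; case: ifP => [xp|_]; last by rewrite mulr_ge0.
have y0 : 0 < x^-1 by rewrite invr_gt0.
have fact0 : 0 < j.+1`!%:R :> R by rewrite ltr0n fact_gt0.
rewrite expRN ler_pdivrMr ?expR_gt0//.
have := @expR_ge1Dxn R x^-1 j (ltW y0).
have -> : x^-1 ^+ j = j.+1`!%:R * x * (x^-1 ^+ j.+1 / j.+1`!%:R).
  have xn := lt0r_neq0 xp; have Fn := lt0r_neq0 fact0.
  rewrite exprS; move: (j.+1`!%:R) Fn => F Fn.
  move: (x^-1 ^+ j) => Y.
  by field; rewrite xn Fn.
move=> h; apply: ler_wpM2l; first by apply: mulr_ge0 => //; exact: ltW.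
by apply: le_trans h; rewrite lerDr.
Qed.

Lemma flat_derive j : primitive (fun x => flat j.+2 x - j%:R * flat j.+1 x) (flat j).
Proof.
move=> x; have [x0|x0|->] := ltrgt0P x.
- have dG (y : R) : is_derive y 1 (fun y : R => y ^+ j * expR (- y))
      (j%:R * y ^+ j.-1 * expR (- y) - y ^+ j * expR (- y)).
    have d1 : is_derive y 1 (fun y : R => expR (- y)) (- expR (- y)).
      have dN : is_derive y 1 (fun y : R => - y) (-1) by exact: is_deriveN.
      have := @is_derive1_comp R expR (fun y => - y) y _ _ (is_derive_expR (- y)) dN.
      by rewrite mulrN1.
    have d2 : is_derive y 1 (fun y : R => y ^+ j) (j%:R * y ^+ j.-1).
      have := @is_deriveX R R id j y 1 1 (is_derive_id y 1).
      by rewrite exprfctE /GRing.scale/= mulr1.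
    apply: is_derive_eq.
    by rewrite /GRing.scale/=; ring.
  have dV : is_derive x 1 (fun x : R => x^-1) (- x^-1 ^+ 2).
    have xn : x != 0 by rewrite gt_eqF.
    have := @is_deriveV R (fun x : R => x) x 1 1 xn (is_derive_id x 1).
    by rewrite /GRing.scale/= mulr1 -exprVn.
  have d := @is_derive1_comp R _ (fun x : R => x^-1) x _ _ (dG x^-1) dV.
  have -> : flat j.+2 x - j%:R * flat j.+1 x = (j%:R * x^-1 ^+ j.-1 * expR (- x^-1) -
      x^-1 ^+ j * expR (- x^-1)) * - x^-1 ^+ 2.
    rewrite /flat x0; case: (j) => [|i] /=; first by rewrite !expr0; ring.
    by rewrite !exprS; ring.
  apply: near_eq_is_derive d.
  by near=> y; rewrite /flat ifT//; near: y; exact: lt_nbhsr.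
- rewrite /flat ltNge (ltW x0)/= mulr0 subr0.
  have d0 : is_derive x 1 (fun=> 0 : R) (0 : R) by exact: is_derive_cst.
  apply: near_eq_is_derive d0.
  near=> y; rewrite /flat ltNge ifF//.
  by apply/negbTE; rewrite negbK ltW//; near: y; exact: lt_nbhsl.
have -> : flat j.+2 0 - j%:R * flat j.+1 0 = 0 by rewrite /flat ltxx mulr0 subr0.
have c : h^-1 *: (flat j (h *: (1:R) + 0) - flat j 0) @[h --> 0^'] --> (0 : R).
  apply/cvgrPdist_le => e e0; near=> h.
  rewrite {2}/flat ltxx subr0 sub0r normrN addr0 /GRing.scale/= mulr1 normrM.
  have [h0|h0|h0] := ltrgt0P h; last by rewrite h0 /flat ltxx normr0 mulr0 ltW.
    rewrite [`|flat _ _|]ger0_norm ?flat_ge0//.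
    have -> : `|h^-1| * flat j h = flat j.+1 h.
      by rewrite /flat h0 exprS mulrA ger0_norm// invr_ge0 ltW.
    apply: le_trans (flat_le _ (ltW h0)) _.
    have fact0 : 0 < j.+2`!%:R :> R by rewrite ltr0n fact_gt0.
    rewrite mulrC -ler_pdivlMr//.
    rewrite -[h]gtr0_norm//.
    near: h; apply: dnbhs0_le; rewrite divr_gt0//.
  by rewrite /flat ltNge (ltW h0)/= normr0 mulr0 ltW.
by split; [apply/cvg_ex; exists 0|exact/cvg_lim].
Unshelve. all: by end_near. Qed.

Lemma flat_Ck n j : Ck n (flat j).
Proof.
elim: n j => [//|n IH] j; exists (fun x => flat j.+2 x - j%:R * flat j.+1 x).
  exact: flat_derive.
have -> : (fun x => flat j.+2 x - j%:R * flat j.+1 x) =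
          (fun x => flat j.+2 x + (- j%:R) * flat j.+1 x).
  by apply/funext => x; rewrite mulNr.
by apply: CkD => //; apply: CkM => //; exact: Ck_cst.
Qed.

(** Smooth functions that tend to the indicator function of ]a, b[. *)
Definition plateau a b n x : R :=
  flat 0 (n.+1%:R * (x - a)) * flat 0 (n.+1%:R * (b - x)).

Lemma plateau_smooth a b n : smooth (plateau a b n).
Proof.
move=> k; apply: CkM.
  have -> : (fun x => flat 0 (n.+1%:R * (x - a))) =
            (fun x => flat 0 (n.+1%:R * x + (- (n.+1%:R * a)))).
    by apply/funext => x; congr flat; ring.
  by apply: Ck_affine; exact: flat_Ck.
have -> : (fun x => flat 0 (n.+1%:R * (b - x))) =
          (fun x => flat 0 (- n.+1%:R * x + n.+1%:R * b)).
  by apply/funext => x; congr flat; ring.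
by apply: Ck_affine; exact: flat_Ck.
Qed.

Lemma flat0_le1 x : flat 0 x <= 1.
Proof.
rewrite /flat; case: ifP => // x0; rewrite expr0 mul1r expR_le1 oppr_le0.
by rewrite invr_ge0 ltW.
Qed.

Lemma plateau_ge0 a b n x : 0 <= plateau a b n x.
Proof. by rewrite mulr_ge0 ?flat_ge0. Qed.

Lemma plateau_le1 a b n x : plateau a b n x <= 1.
Proof. by rewrite -[leRHS]mulr1 ler_pM ?flat_ge0 ?flat0_le1. Qed.

Lemma plateau_out a b n x : ~~ (a < x < b) -> plateau a b n x = 0.
Proof.
rewrite negb_and -!leNgt /plateau => /orP[xa|bx].
  rewrite {1}/flat ltNge ifF ?mul0r//; apply/negbTE; rewrite negbK.
  by rewrite mulr_ge0_le0// subr_le0.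
rewrite {2}/flat ltNge ifF ?mulr0//; apply/negbTE; rewrite negbK.
by rewrite mulr_ge0_le0// subr_le0.
Qed.

Lemma plateau_cvg a b x : a < x < b -> plateau a b n x @[n --> \oo] --> (1 : R).
Proof.
move=> /andP[ax xb].
have aux c : 0 < c -> flat 0 (n.+1%:R * c) @[n --> \oo] --> (1 : R).
  move=> c0.
  have -> : (fun n => flat 0 (n.+1%:R * c)) = (fun n => expR (- (n.+1%:R^-1 * c^-1))).
    by apply/funext => n; rewrite /flat mulr_gt0// expr0 mul1r invfM.
  rewrite -[X in _ --> X]expR0.
  apply: continuous_cvg; first exact: continuous_expR.
  rewrite -[X in _ --> X]oppr0; apply: cvgN.
  rewrite -[X in _ --> X](mul0r c^-1); apply: cvgM; last exact: cvg_cst.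
  exact: cvg_harmonic.
rewrite -[X in _ --> X]mulr1; apply: cvgM; apply: aux; rewrite subr_gt0//.
Qed.

End smooth.

(** * The fundamental lemma of the calculus of variations *)

Section fundamental.
Context {R : realType}.
Implicit Types (f g h H Z : R -> R) (a b x y c t e C q M : R) (n j k : nat).
Local Notation mu := (@lebesgue_measure R).

Lemma locint_mul_L1 Z g a b M : locint Z -> measurable_fun [set: R] g ->
  (forall x, `|g x| <= M) -> (forall x, ~~ (a <= x <= b) -> g x = 0) ->
  L1 (fun x => g x * Z x).
Proof.
move=> [mZ iZ] mg gM g0.
have i1 := L1M mg gM ((integrable_restrict Z a b).1 (iZ a b)).
have E : (fun x => g x * Z x) = (fun x => g x * (Z \_ `[a, b]) x).
  apply/funext => x; rewrite patchE mem_setE in_itv/=.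
  by case: ifPn => // /g0 ->; rewrite !mul0r.
by rewrite E.
Qed.

Lemma plateau_norm a b k x : `|plateau a b k x| <= 1.
Proof. by rewrite ger0_norm ?plateau_le1// plateau_ge0. Qed.

Lemma plateau_zero a b k x : ~~ (a <= x <= b) -> plateau a b k x = 0.
Proof.
move=> h; apply: plateau_out; apply: contra h => /andP[ax xb].
by rewrite !ltW.
Qed.

Lemma plateau_cont a b k : continuous (plateau a b k).
Proof. exact/smooth_continuous/plateau_smooth. Qed.

Lemma plateau_L1 Z a b k : locint Z -> L1 (fun x => plateau a b k x * Z x).
Proof.
move=> lZ; apply: (@locint_mul_L1 Z _ a b 1) => //.
- exact: continuous_meas (@plateau_cont a b k).
- exact: plateau_norm.
- exact: plateau_zero.
Qed.

(** Dominated convergence along the plateaus of [a, b]. *)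
Lemma plateau_interval Z a b : locint Z -> a < b ->
  (forall k, \int[mu]_x (plateau a b k x * Z x) = 0) ->
  \int[mu]_(x in `[a, b]) Z x = 0.
Proof.
move=> lZ ab Z0; have [mZ iZ] := lZ.
pose f_ k x := (plateau a b k x * Z x)%:E.
pose f x := ((Z \_ `]a, b[) x)%:E.
pose g x := `|(Z \_ `[a, b]) x|%:E.
have mf_ k : measurable_fun [set: R] (f_ k).
  by apply/measurable_EFinP; exact: L1_meas (plateau_L1 a b k lZ).
have mf : measurable_fun [set: R] f.
  apply/measurable_EFinP; apply/(measurable_restrictT _ _).1 => //.
  exact: measurable_funTS.
have ff x : f_ ^~ x @ \oo --> f x.
  have c : plateau a b k x * Z x @[k --> \oo] --> (Z \_ `]a, b[) x.
    rewrite patchE mem_setE in_itv/=; case: ifPn => xab.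
      rewrite -[X in _ --> X]mul1r; apply: cvgM; last exact: cvg_cst.
      exact: plateau_cvg.
    under eq_fun do rewrite plateau_out ?mul0r//.
    exact: cvg_cst.
  by apply: cvg_EFin; [exact: nearW|exact: c].
have ig : mu.-integrable [set: R] g.
  exact: (L1_norm ((integrable_restrict Z a b).1 (iZ a b))).
have fg x k : (`|f_ k x| <= g x)%E.
  rewrite /f_ /g lee_fin patchE mem_setE in_itv/=; case: ifPn => xab.
    by rewrite normrM ler_piMl// plateau_norm.
  by rewrite plateau_zero// mul0r.
have aeff : {ae mu, forall x, [set: R] x -> f_ ^~ x @ \oo --> f x}.
  by apply: aeW => x _; exact: ff.
have aefg : {ae mu, forall x k, [set: R] x -> (`|f_ k x| <= g x)%E}.
  by apply: aeW => x k _; exact: fg.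
have [_ _] := @dominated_convergence _ (measurableTypeR R) R mu setT measurableT
  f_ f g mf_ mf aeff ig aefg.
have -> : (fun k => \int[mu]_x f_ k x)%E = (fun=> 0%E).
  by apply/funext => k; rewrite Rintegral_EFin ?Z0//; exact: plateau_L1.
move=> c; have c0 : (\int[mu]_x f x = 0)%E.
  by apply: (cvg_unique _ c) => //; exact: cvg_cst.
have E1 : \int[mu]_(x in `]a, b[) Z x = 0.
  by rewrite Rintegral_mkcond /Rintegral c0.
have ioo : mu.-integrable `]a, b[ (EFin \o Z).
  by apply: integrableS (iZ a b) => //; exact: subset_itv_oo_cc.
have ico : mu.-integrable `[a, b[ (EFin \o Z).
  by apply: integrableS (iZ a b) => //; exact: subset_itv_co_cc.
by rewrite -Rintegral_itv_bndo_bndc// -Rintegral_itv_obnd_cbnd.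
Qed.

(** Lebesgue's differentiation theorem. *)
Lemma intervals_ae_zero Z : locint Z ->
  (forall a b, a < b -> \int[mu]_(x in `[a, b]) Z x = 0) ->
  {ae mu, forall x, Z x = 0}.
Proof.
move=> lZ Z0; have [mZ iZ] := lZ.
have H n : {ae mu, forall x, - n%:R < x -> Z x = 0}.
  have := @FTC1 R Z (BLeft (- n%:R)) (iZ _) (locint_loc lZ).
  apply: filterS; first exact: (ae_filter_ringOfSetsType mu).
  move=> x h nx.
  have [|_ <-] := h; first by rewrite lte_fin.
  have d0 : is_derive x 1 (fun x => \int[mu]_(t in `[- n%:R, x]) Z t) 0.
    have d1 : is_derive x 1 (fun=> 0 : R) (0 : R) by exact: is_derive_cst.
    apply: near_eq_is_derive d1.
    near=> y; rewrite Z0//; near: y; exact: lt_nbhsr.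
  by rewrite derive1E; case: d0.
have := ae_foralln H; apply: filterS.
move=> x Hx.
apply: (Hx (Num.bound `|x|)).
have := @archi_boundP R `|x| (normr_ge0 _); have := ler_norm (- x); rewrite normrN; lra.
Unshelve. all: by end_near. Qed.

Lemma plateau_ae_zero Z : locint Z ->
  (forall a b k, \int[mu]_x (plateau a b k x * Z x) = 0) ->
  {ae mu, forall x, Z x = 0}.
Proof.
move=> lZ Z0; apply: intervals_ae_zero => // a b ab.
by apply: plateau_interval.
Qed.

Lemma locint_avg_continuous h : locint h -> continuous (avg h).
Proof.
move=> [mh ih] x.
pose N := x - 2; pose M := x + 2.
pose F y := \int[mu]_(t in `[N, y]) h t.
have cF : {within `[N, M], continuous F}.
  by apply: parameterized_integral_continuous; [rewrite /N /M; lra|exact: ih].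
have cFx y : N < y -> y < M -> {for y, continuous F}.
  move=> Ny yM; have := cF; rewrite continuous_within_itvP; last by rewrite /N /M; lra.
  by move=> [c _ _]; apply: c; rewrite in_itv/= Ny.
have E y : `|x - y| < 1 -> avg h y = F (y + 2^-1) - F (y - 2^-1).
  rewrite ltr_norml => /andP[y1 y2]; rewrite /avg /F.
  have /= := @Rintegral_itvB R h (BLeft N) (BRight (y + 2^-1)) (y - 2^-1) (ih _ _).
  rewrite !bnd_simp => -> //; last 2 first.
    by rewrite /N; lra.
    by lra.
  rewrite Rintegral_itv_obnd_cbnd//.
  apply: integrableS (ih (y - 2^-1) (y + 2^-1)) => //; try exact: measurable_itv.
  by apply: subset_itvr; rewrite bnd_simp.
have c : {for x, continuous (fun y => F (y + 2^-1) - F (y - 2^-1))}.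
  apply: cvgB.
    apply: (@continuous_comp _ _ _ (fun y => y + 2^-1) F).
      by apply: cvgD; [exact: cvg_id|exact: cvg_cst].
    by apply: cFx; rewrite /N /M; lra.
  apply: (@continuous_comp _ _ _ (fun y => y - 2^-1) F).
    by apply: cvgB; [exact: cvg_id|exact: cvg_cst].
  by apply: cFx; rewrite /N /M; lra.
rewrite /continuous_at E; last by rewrite subrr normr0.
apply: cvg_trans c; apply: near_eq_cvg.
by near=> y; rewrite E//; near: y; exact: cvgr_dist_lt.
Unshelve. all: by end_near. Qed.

End fundamental.

(** * Weak solutions are averages *)

Section weak.
Context {R : realType}.
Implicit Types (f g h H Z : R -> R) (a b x y c t e C q M T : R) (n j k : nat).
Local Notation mu := (@lebesgue_measure R).

Lemma L2_sqr f : L2 f -> L1 (fun x => f x ^+ 2).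
Proof. exact: Lfun2_integrable_sqr. Qed.

(** The elementary |t| <= 1 + t^2 does the work of the Cauchy-Schwarz inequality
    in the estimates for functions in the weighted space. *)
Lemma weighted_bound a f x y : 0 < a -> x <= y ->
  `|f y| <= expR (- a * x) * (1 + weighted a f y ^+ 2).
Proof.
move=> a0 xy.
have E : f y = expR (- a * y) * weighted a f y.
  by rewrite /weighted mulrA -expRD mulNr addNr expR0 mul1r.
rewrite {1}E normrM (ger0_norm (expR_ge0 _)) ler_pM ?expR_ge0//.
  by rewrite ler_expR; nra.
set t := weighted a f y; have := normr_ge0 t; rewrite -(real_normK (num_real t)).
by move: (`|t|) => s s0; nra.
Qed.

Lemma avg_cst1 x : \int[mu]_y (window x y * 1) = 1 :> R.
Proof.
rewrite -avg_window.
by have [c _ ->] := @avg_mean R (fun=> 1) x (@cst_continuous _ _ _).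
Qed.

Lemma avg_weighted_bound a h x : 0 < a -> locint h -> L2 (weighted a h) ->
  `|avg h x| <= expR (- a * (x - 2^-1)) * (1 + \int[mu]_y (weighted a h y ^+ 2)).
Proof.
move=> a0 lh h2; have iq := L2_sqr h2.
have l1 : locint (fun=> 1 : R) by apply: continuous_locint; exact: cst_continuous.
rewrite avg_window; apply: le_trans (le_normr_Rintegral _ (window_L1 x lh)) _ => //.
have -> : 1 + \int[mu]_y (weighted a h y ^+ 2) =
    \int[mu]_y (window x y * 1 + weighted a h y ^+ 2).
  by rewrite RintegralD// ?avg_cst1//; exact: window_L1.
rewrite -RintegralZl//; last by apply: L1D => //; exact: window_L1.
apply: L1_le_Rintegral.
- by apply: L1_norm; exact: window_L1.
- by apply/L1Z/L1D => //; exact: window_L1.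
move=> y; rewrite mulr1 normrM (ger0_norm (window_ge0 _ _)) /window.
case: (boolP (`|x - y| <= 2^-1)) => [|_]; last first.
  by rewrite mul0r add0r mulr_ge0 ?expR_ge0// sqr_ge0.
rewrite ler_norml => /andP[? ?]; rewrite mul1r; apply: weighted_bound => //; lra.
Qed.

Lemma exp_decay_zero a c K : 0 < a ->
  (forall T, 0 <= T -> `|c| <= expR (- a * T) * K) -> c = 0.
Proof.
move=> a0 h; apply/eqP/negPn/negP => c0.
have cp : 0 < `|c| by rewrite normr_gt0.
have K0 : 0 <= K by have := h 0 (lexx 0); rewrite mulr0 expR0 mul1r; lra.
(* With this T, the bound exp (a T) >= 1 + a T gives |c| + K <= K. *)
pose T := K / (a * `|c|).
have T0 : 0 <= T by rewrite divr_ge0// mulr_ge0// ltW.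
have := h T T0; rewrite mulNr expRN mulrC ler_pdivlMr ?expR_gt0//.
have e1 := expR_ge1Dx (a * T).
have aT : `|c| * (a * T) = K by rewrite /T; field; rewrite !gt_eqF.
have : `|c| * (1 + a * T) <= `|c| * expR (a * T) by rewrite ler_wpM2l// ltW.
by rewrite mulrDr mulr1 aT => h1 h2; lra.
Qed.

Section difference.
Context (al be T : R) (k : nat) (T0 : 0 <= T).
Let eta := plateau al be k.
(** A plateau eta has no compactly supported primitive, but its difference psi
    with a translate has one, namely phi. *)
Let psi x := eta x - eta (x - T).
Let phi x := \int[mu]_(y in `[x - T, x]) eta y.

Let eta_cont : continuous eta. Proof. exact: plateau_cont. Qed.

Let eta_shift_cont c : continuous (fun x => eta (x + c)).
Proof.
move=> x; apply: (@continuous_comp _ _ _ (fun x => x + c) eta); last exact: eta_cont.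
by apply: cvgD; [exact: cvg_id|exact: cvg_cst].
Qed.

Lemma psi_cont : continuous psi.
Proof. by move=> x; apply: cvgB; [exact: eta_cont|exact: (eta_shift_cont (c := - T))]. Qed.

Lemma phi_derive : primitive psi phi.
Proof.
have [H dH] := primitive_ex eta_cont.
have -> : phi = fun x => H x - H (x - T).
  by apply/funext => x; rewrite /phi (primitive_Rintegral eta_cont dH)//; have := T0; lra.
move=> x; have d1 := dH x.
have d2 : is_derive x 1 (fun y => H (y - T)) (eta (x - T)).
  by apply: (@is_derive_shiftc R H (- T)); exact: dH.
exact: is_deriveB.
Qed.

Lemma phi_smooth : smooth phi.
Proof.
move=> n; apply: CkS; exists psi; first exact: phi_derive.
have -> : psi = fun x => eta x + (-1) * eta (1 * x + (- T)).
  by apply/funext => x; rewrite /psi mulN1r mul1r.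
apply: CkD; first exact: plateau_smooth.
by apply: CkM; [exact: Ck_cst|apply: Ck_affine; exact: plateau_smooth].
Qed.

Let M := `|al| + `|be| + T.

Lemma eta_far x : ~~ (- M <= x <= M) -> eta x = 0.
Proof.
move=> h; apply: plateau_zero; apply: contra h => /andP[h1 h2].
have := ler_norm (- al); have := ler_norm be; rewrite normrN => ? ?.
have := normr_ge0 al; have := normr_ge0 be => ? ?.
by have := T0; rewrite /M => ?; apply/andP; split; lra.
Qed.

Lemma psi_far x : ~~ (- M <= x <= M) -> psi x = 0.
Proof.
move=> h; rewrite /psi eta_far// sub0r.
suff -> : eta (x - T) = 0 by rewrite oppr0.
apply: plateau_zero; apply: contra h => /andP[h1 h2].
have := ler_norm (- al); have := ler_norm be; rewrite normrN => ? ?.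
have := normr_ge0 al; have := normr_ge0 be => ? ?.
by have := T0; rewrite /M => ?; apply/andP; split; lra.
Qed.

Lemma phi_far x : ~~ (- M <= x <= M) -> phi x = 0.
Proof.
move=> h; rewrite /phi (@eq_Rintegral _ _ _ mu _ (fun=> 0)).
  by rewrite (_ : (fun=> 0) = (fun x => 0 * 0)) ?Rintegral_cst ?mul0r//;
     apply/funext => z; rewrite mul0r.
move=> y; rewrite inE/= in_itv/= => /andP[y1 y2]; apply: plateau_zero.
apply: contra h => /andP[h1 h2].
have := ler_norm (- al); have := ler_norm be; rewrite normrN => ? ?.
have := normr_ge0 al; have := normr_ge0 be => ? ?.
by have := T0; rewrite /M => ?; apply/andP; split; lra.
Qed.

Lemma phi_test : test_function phi.
Proof.
apply: (smooth_test (M := M)) phi_smooth _ => x h; apply: phi_far.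
by rewrite -ler_norml -ltNge.
Qed.

Lemma psi_norm x : `|psi x| <= 1.
Proof.
have := plateau_ge0 al be k x; have := plateau_le1 al be k x.
have := plateau_ge0 al be k (x - T); have := plateau_le1 al be k (x - T).
by rewrite /psi /eta => ? ? ? ?; rewrite ler_norml; apply/andP; split; lra.
Qed.

Lemma phi_norm x : `|phi x| <= T.
Proof.
rewrite /phi.
apply: le_trans (le_normr_Rintegral _ (continuous_integrable_cc _ _ eta_cont)) _ => //.
have ET : \int[mu]_(y in `[x - T, x]) 1 = T.
  have d1 : primitive (fun=> 1 : R) (fun x : R => x) by move=> y; exact: is_derive_id.
  rewrite (primitive_Rintegral (@cst_continuous _ _ _) d1); have := T0; lra.
rewrite -[leRHS]ET; apply: le_Rintegral => //.
- have := continuous_integrable_cc (x - T) x eta_cont => i1.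
  apply: continuous_integrable_cc; exact: norm_continuous_comp.
- by apply: continuous_integrable_cc; exact: cst_continuous.
- by move=> y _; exact: plateau_norm.
Qed.

(** Test the equation of S with phi: translations move nabla from W to phi, where
    nabla phi = avg psi, and [avg_adjoint] moves the average back to W. *)
Lemma weak_difference S W dS : weak_derivative S dS -> locint W ->
  {ae mu, forall x, dS x = nabla W x} ->
  \int[mu]_x (eta x * (S x - avg W x)) = \int[mu]_x (eta (x - T) * (S x - avg W x)).
Proof.
move=> [lS ldS wd] lW dSW.
have [mW _] := lW; have [mdS _ _] := ldS; have lS' := loc_locint lS.
have cpsi := psi_cont; have mpsi := continuous_meas cpsi.
have cphi := is_derive_continuous phi_derive; have mphi := continuous_meas cphi.
have lA : locint (avg W) by apply: continuous_locint; exact: locint_avg_continuous.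
have iSpsi : L1 (fun x => psi x * S x) by exact: (locint_mul_L1 lS' mpsi psi_norm psi_far).
have iApsi : L1 (fun x => psi x * avg W x) by exact: (locint_mul_L1 lA mpsi psi_norm psi_far).
have lWs c := locint_shift c lW.
have iWphi c : L1 (fun x => phi x * W (x + c)).
  exact: (locint_mul_L1 (lWs c) mphi phi_norm phi_far).
have E1 : \int[mu]_x (psi x * S x) = - \int[mu]_x (phi x * nabla W x).
  have := wd phi phi_test; rewrite (primitive_derive1 phi_derive).
  have -> : (\int[mu]_x (dS x * phi x)%:E = \int[mu]_x (phi x * nabla W x)%:E)%E.
    apply: ae_eq_integral => //.
    - by apply/measurable_EFinP; exact: measurable_funM.
    - apply/measurable_EFinP; apply: measurable_funM => //.
      by apply: measurable_funB; [case: (lWs 2^-1)|case: (lWs (- 2^-1))].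
    - apply: filterS dSW; first exact: (ae_filter_ringOfSetsType mu).
      by move=> x E _; rewrite E mulrC.
  have -> : (\int[mu]_x (S x * psi x)%:E = \int[mu]_x (psi x * S x)%:E)%E.
    by apply: eq_integral => x _; rewrite mulrC.
  by rewrite /Rintegral => ->; rewrite fineN.
have E2 : \int[mu]_x (phi x * nabla W x) = - \int[mu]_x (W x * avg psi x).
  have -> : \int[mu]_x (phi x * nabla W x) =
      \int[mu]_x (phi x * W (x + 2^-1)) - \int[mu]_x (phi x * W (x + - 2^-1)).
    rewrite -RintegralB//; [|exact: iWphi|exact: iWphi].
    by apply: eq_Rintegral => x _; rewrite /nabla mulrBr.
  have s1 c : \int[mu]_x (phi x * W (x + c)) = \int[mu]_x (phi (x - c) * W x).
    rewrite -[RHS](preserves_Rintegral (preserves_shift c)).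
      by apply: eq_Rintegral => x _; rewrite addrK.
    apply: measurable_funM => //; apply: measurableT_comp => //.
    by case: (preserves_shift (- c)).
  rewrite !s1 -RintegralB//; last 2 first.
    have := L1_shift (- 2^-1) (iWphi 2^-1).
    by apply: eq_integrable => // x _ /=; rewrite subrK.
    have := L1_shift 2^-1 (iWphi (- 2^-1)).
    by apply: eq_integrable => // x _ /=; rewrite addrK opprK.
  rewrite -[RHS]mulN1r -[RHS]RintegralZl//; last first.
    have := L1B (L1_shift 2^-1 (iWphi (- 2^-1))) (L1_shift (- 2^-1) (iWphi 2^-1)).
    apply: eq_integrable => // x _ /=; congr EFin.
    by rewrite (primitive_avg _ cpsi phi_derive) addrK subrK; ring.
  apply: eq_Rintegral => x _; rewrite (primitive_avg _ cpsi phi_derive) opprK; ring.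
have E3 : \int[mu]_x (W x * avg psi x) = \int[mu]_x (psi x * avg W x).
  rewrite -avg_adjoint//; first exact: continuous_locint.
  have lA' : locint (avg (fun y => `|W y|)).
    by apply/continuous_locint/locint_avg_continuous/locint_norm.
  apply: (locint_mul_L1 (M := 1) lA').
  - exact: measurableT_comp.
  - by move=> x; rewrite normr_id psi_norm.
  - by move=> x /psi_far ->; rewrite normr0.
pose Z x := S x - avg W x.
have lZ : locint Z by exact: locintB.
have iZ : L1 (fun x => eta x * Z x) by exact: plateau_L1.
have iZT : L1 (fun x => eta (x - T) * Z x).
  have := L1_shift (- T) (plateau_L1 al be k (locint_shift T lZ)).
  by apply: eq_integrable => // x _ /=; rewrite subrK.
apply/eqP; rewrite -subr_eq0 -RintegralB//; apply/eqP.
transitivity (\int[mu]_x (psi x * S x - psi x * avg W x)).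
  by apply: eq_Rintegral => x _; rewrite /psi /Z; ring.
by rewrite RintegralB// E1 E2 opprK E3 subrr.
Qed.

End difference.

(** By [weak_difference] the function S - avg W has the same integral against a
    plateau and against all translates of it to the right, and there the weight
    forces these integrals to tend to 0. *)
Theorem weak_avg a S W dS : 0 < a -> weak_derivative S dS -> locint W ->
  {ae mu, forall x, dS x = nabla W x} ->
  L2 (weighted a S) -> L2 (weighted a W) ->
  {ae mu, forall x, S x = avg W x}.
Proof.
move=> a0 wd lW dSW S2 W2.
have lS : locint S by apply: loc_locint; case: wd.
have lA : locint (avg W) by apply: continuous_locint; exact: locint_avg_continuous.
have lZ : locint (fun x => S x - avg W x) by exact: locintB.
have : {ae mu, forall x, S x - avg W x = 0}.
  apply: plateau_ae_zero => // al be k.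
  pose N := \int[mu]_y (weighted a W y ^+ 2).
  have N0 : 0 <= N by apply: Rintegral_ge0 => x _; rewrite sqr_ge0.
  pose c2 := expR (- a * al).
  pose c1 := c2 + expR (- a * (al - 2^-1)) * (1 + N).
  have c20 : 0 <= c2 by exact: expR_ge0.
  have c10 : 0 <= c1.
    by rewrite addr_ge0// mulr_ge0 ?expR_ge0//; lra.
  have i1 : L1 (fun x => plateau al be k x * 1).
    by apply: plateau_L1; apply: continuous_locint; exact: cst_continuous.
  pose K := c1 * \int[mu]_x (plateau al be k x * 1) +
            c2 * \int[mu]_y (weighted a S y ^+ 2).
  apply: (@exp_decay_zero a _ K a0) => T T0.
  rewrite (@weak_difference al be T k T0 S W dS)//.
  have i1T : L1 (fun x => plateau al be k (x - T) * 1).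
    exact: (L1_shift (- T) i1).
  have iqS := L2_sqr S2.
  have iZT : L1 (fun x => plateau al be k (x - T) * (S x - avg W x)).
    have := L1_shift (- T) (plateau_L1 al be k (locint_shift T lZ)).
    by apply: eq_integrable => // x _ /=; rewrite subrK.
  apply: le_trans (le_normr_Rintegral _ iZT) _ => //.
  have I1 : \int[mu]_x (plateau al be k (x - T) * 1) =
      \int[mu]_x (plateau al be k x * 1).
    exact: (preserves_Rintegral (preserves_shift (- T)) (L1_meas i1)).
  have -> : expR (- a * T) * K = \int[mu]_x (expR (- a * T) *
      (c1 * (plateau al be k (x - T) * 1) + c2 * (weighted a S x ^+ 2))).
    rewrite RintegralZl//; last by apply: L1D; exact: L1Z.
    rewrite RintegralD//; [|exact: L1Z..].
    rewrite (RintegralZl c1 measurableT i1T) (RintegralZl c2 measurableT iqS).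
    by rewrite I1.
  apply: L1_le_Rintegral.
  - exact: L1_norm.
  - by apply/L1Z/L1D; exact: L1Z.
  move=> x; rewrite mulr1.
  have p0 := plateau_ge0 al be k (x - T); have p1 := plateau_le1 al be k (x - T).
  have q0 : 0 <= weighted a S x ^+ 2 by exact: sqr_ge0.
  have [xT|xT] := leP (al + T) x; last first.
    rewrite plateau_zero; last by apply/negP => /andP[]; lra.
    rewrite mul0r normr0 mulr0 add0r.
    by apply: mulr_ge0; [exact: expR_ge0|exact: mulr_ge0].
  have hS := weighted_bound S a0 xT.
  have hW := avg_weighted_bound x a0 lW W2.
  rewrite -/N in hW.
  have hW' : `|avg W x| <= expR (- a * T) * (expR (- a * (al - 2^-1)) * (1 + N)).
    apply: le_trans hW _; rewrite mulrA -expRD ler_wpM2r//; first by lra.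
    by rewrite ler_expR; nra.
  have hS' : `|S x| <= expR (- a * T) * (c2 * (1 + weighted a S x ^+ 2)).
    by rewrite mulrA -expRD -mulrDr [T + al]addrC.
  rewrite normrM (ger0_norm p0).
  set p := plateau _ _ _ _ in p0 p1 *.
  set q := weighted a S x ^+ 2 in q0 hS' *.
  have hZ : `|S x - avg W x| <= expR (- a * T) * (c1 + c2 * q).
    apply: le_trans (ler_normB _ _) _; apply: le_trans (lerD hS' hW') _.
    rewrite -mulrDr; apply: ler_wpM2l; first exact: expR_ge0.
    by rewrite /c1 [c2 * (1 + _)]mulrDr mulr1; lra.
  apply: (@le_trans _ _ (p * (expR (- a * T) * (c1 + c2 * q)))).
    by rewrite ler_wpM2l.
  rewrite mulrCA ler_wpM2l ?expR_ge0//.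
  have : 0 <= c2 * q by rewrite mulr_ge0.
  by move: c10 p0 p1; nra.
apply: filterS; first exact: (ae_filter_ringOfSetsType mu).
by move=> x; lra.
Qed.

End weak.

(** * Classical derivatives as weak derivatives *)

Section transfer.
Context {R : realType}.
Implicit Types (f g h u H Z : R -> R) (a b x y c t e C q M T : R) (n j k : nat).
Local Notation mu := (@lebesgue_measure R).

Definition ae_same f g := {ae mu, forall x, f x = g x}.

Lemma ae_impl (P Q : R -> Prop) : (forall x, P x -> Q x) ->
  {ae mu, forall x, P x} -> {ae mu, forall x, Q x}.
Proof.
by move=> PQ; apply: filterS; first exact: (ae_filter_ringOfSetsType mu).
Qed.

Lemma ae_impl2 (P P' Q : R -> Prop) : (forall x, P x -> P' x -> Q x) ->
  {ae mu, forall x, P x} -> {ae mu, forall x, P' x} -> {ae mu, forall x, Q x}.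
Proof.
by move=> PQ; apply: filterS2; first exact: (ae_filter_ringOfSetsType mu).
Qed.

Lemma ae_Rintegral f g : measurable_fun [set: R] f -> measurable_fun [set: R] g ->
  ae_same f g -> (\int[mu]_x (f x)%:E = \int[mu]_x (g x)%:E)%E.
Proof.
move=> mf mg fg; apply: ae_eq_integral => //; [exact/measurable_EFinP|exact/measurable_EFinP|].
by apply: ae_impl fg => x -> _.
Qed.

Lemma L1_ae f g : measurable_fun [set: R] f -> ae_same f g -> L1 g -> L1 f.
Proof.
move=> mf fg ig; have /integrableP[_ ioo] := ig.
apply/integrableP; split; first exact/measurable_EFinP.
move: ioo; congr (_ < _)%E; apply: (@ae_Rintegral (fun x => `|g x|) (fun x => `|f x|)).
- by apply: measurableT_comp => //; exact: L1_meas.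
- exact: measurableT_comp.
- by apply: ae_impl fg => x ->.
Qed.

Lemma locint_ae f g : measurable_fun [set: R] f -> ae_same f g -> locint g -> locint f.
Proof.
move=> mf fg [mg ig]; split => // a b; apply/integrable_restrict.
apply: (L1_ae _ _ ((integrable_restrict g a b).1 (ig a b))).
  by apply/(measurable_restrictT _ _).1 => //; exact: measurable_funTS.
by apply: ae_impl fg => x E; rewrite !patchE E.
Qed.

Lemma L2_ae f g : measurable_fun [set: R] f -> ae_same f g -> L2 g -> L2 f.
Proof.
move=> mf fg g2; apply: L2_criterion => //.
apply: (L1_ae _ _ (L2_sqr g2)); first exact: measurable_funX.
by apply: ae_impl fg => x ->.
Qed.

Lemma nabla_ae f g : ae_same f g -> ae_same (nabla f) (nabla g).
Proof.
move=> fg.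
have h1 := preserves_ae (preserves_shift 2^-1) fg.
have h2 := preserves_ae (preserves_shift (- 2^-1)) fg.
by apply: ae_impl2 h1 h2 => x; rewrite /nabla => -> ->.
Qed.

Lemma avg_ae f g : locint f -> locint g -> ae_same f g -> forall x, avg f x = avg g x.
Proof.
move=> lf lg fg x; rewrite !avg_window /Rintegral; congr fine.
apply: ae_Rintegral; [exact: L1_meas (window_L1 x lf)|exact: L1_meas (window_L1 x lg)|].
by apply: ae_impl fg => y ->.
Qed.

Lemma locint_bounded_mul M g f : measurable_fun [set: R] g -> (forall x, `|g x| <= M) ->
  locint f -> locint (fun x => g x * f x).
Proof.
move=> mg gM [mf intf]; split; first exact: measurable_funM.
move=> a b; apply/integrable_restrict.
have := L1M mg gM ((integrable_restrict f a b).1 (intf a b)).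
apply: eq_integrable => // x _ /=; rewrite !patchE; case: ifP => // _.
by congr EFin; rewrite mulr0.
Qed.

Lemma supported_Rintegral g a b : continuous g ->
  (forall x, ~~ (a <= x <= b) -> g x = 0) ->
  (\int[mu]_x (g x)%:E = (\int[mu]_(x in `[a, b]) g x)%:E)%E /\ L1 g.
Proof.
move=> cg g0.
have E : g = g \_ `[a, b].
  apply/funext => x; rewrite patchE mem_setE in_itv/=.
  by case: ifPn => // /g0.
have i1 : L1 g by rewrite E; apply/integrable_restrict; exact: continuous_integrable_cc.
split => //; rewrite Rintegral_EFin//; congr EFin.
by rewrite [RHS]Rintegral_mkcond -E.
Qed.

(** Integration by parts on an interval that contains the support of the test
    function. *)
Lemma primitive_weak f df u : primitive df f -> continuous df ->
  measurable_fun [set: R] u -> ae_same u f -> weak_derivative u df.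
Proof.
move=> d cdf mu_ uf; have cf := is_derive_continuous d.
have lf := continuous_locint cf.
split; [exact/locint_loc/(locint_ae mu_ uf)|exact/locint_loc/continuous_locint|].
move=> phi [dphi cphi].
have d1 : primitive (phi^`())%classic phi.
  by move=> x; split; [exact: (dphi 0%N x)|rewrite derive1E].
have cd1 : continuous (phi^`())%classic.
  move=> x; apply: (@is_derive_cont R _ x ((phi^`(2))%classic x)).
  have := dphi 1%N x; rewrite derive1n1 => dd.
  by split; [exact: dd|rewrite -derive1E derive1nS derive1n1].
have cp := is_derive_continuous d1.
have [M0 [_ HM0]] := compact_bounded cphi.
pose M := `|M0| + 1.
have phi0 x : M < `|x| -> phi x = 0.
  move=> Mx; apply/eqP/negPn/negP => px.
  have := HM0 M; rewrite /M => /(_ _)/(_ x).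
  have M0M : M0 < `|M0| + 1 by have := ler_norm M0; lra.
  move=> /(_ M0M)/= H.
  have : `|x| <= `|M0| + 1 by apply: H; exact: subset_closure.
  by move: Mx; rewrite /M; lra.
have dphi0 x : M < `|x| -> (phi^`())%classic x = 0.
  move=> Mx; rewrite derive1E.
  suff : is_derive x 1 phi 0 by case.
  have d0 : is_derive x 1 (fun=> 0 : R) (0 : R) by exact: is_derive_cst.
  apply: near_eq_is_derive d0.
  have [x0|x0] := leP 0 x.
    have Mx' : M < x by rewrite ger0_norm in Mx.
    near=> y; rewrite phi0//; apply: lt_le_trans (ler_norm y).
    by near: y; exact: lt_nbhsr.
  have Mx' : x < - M by rewrite ltr0_norm// in Mx; lra.
  near=> y; rewrite phi0//; rewrite -normrN; apply: lt_le_trans (ler_norm (- y)).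
  by rewrite ltrNr; near: y; exact: lt_nbhsl.
have outside x : ~~ (- (M + 1) <= x <= M + 1) -> M < `|x|.
  by rewrite -ler_norml -ltNge; lra.
have cfp : continuous (fun x => f x * (phi^`())%classic x).
  by move=> x; apply: cvgM; [exact: cf|exact: cd1].
have cdp : continuous (fun x => df x * phi x).
  by move=> x; apply: cvgM; [exact: cdf|exact: cp].
have mphi' : measurable_fun [set: R] (phi^`())%classic by exact: continuous_meas.
have -> : (\int[mu]_x (u x * (phi^`())%classic x)%:E =
           \int[mu]_x (f x * (phi^`())%classic x)%:E)%E.
  apply: ae_Rintegral; [exact: measurable_funM|exact: continuous_meas|].
  by apply: ae_impl uf => x ->.
have zf x : ~~ (- (M + 1) <= x <= M + 1) -> f x * (phi^`())%classic x = 0.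
  by move=> /outside/dphi0 ->; rewrite mulr0.
have zd x : ~~ (- (M + 1) <= x <= M + 1) -> df x * phi x = 0.
  by move=> /outside/phi0 ->; rewrite mulr0.
have [-> _] := supported_Rintegral cfp zf.
have [-> _] := supported_Rintegral cdp zd.
rewrite -EFinN; congr EFin; apply/eqP; rewrite -addr_eq0; apply/eqP.
rewrite -RintegralD//; [|exact: continuous_integrable_cc..].
have dP : primitive (fun x => f x * (phi^`())%classic x + df x * phi x)
    (fun x => f x * phi x).
  move=> x; have h1 := d x; have h2 := d1 x; apply: is_derive_eq.
  by rewrite /GRing.scale/=; ring.
have M0' : 0 <= M by rewrite /M addr_ge0.
have cs : continuous (fun x => f x * (phi^`())%classic x + df x * phi x).
  by move=> x; apply: cvgD; [exact: cfp|exact: cdp].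
rewrite (primitive_Rintegral cs dP); last by lra.
have n1 : M < `|M + 1| by rewrite ger0_norm; lra.
by rewrite !phi0 ?normrN// !mulr0 subrr.
Unshelve. all: by end_near. Qed.

Lemma weighted_derive a f df : primitive df f ->
  primitive (fun x => a * weighted a f x + weighted a df x) (weighted a f).
Proof.
move=> d x; have h := d x.
have d1 : is_derive x 1 (fun x : R => expR (a * x)) (expR (a * x) * a).
  have d2 : is_derive x 1 (fun x : R => a * x) a.
    by apply: is_derive_eq; rewrite /GRing.scale/= mulr1.
  exact: (@is_derive1_comp R expR (fun x => a * x) x _ _ (is_derive_expR _) d2).
rewrite /weighted; apply: is_derive_eq.
by rewrite /GRing.scale/=; ring.
Qed.

Lemma weighted_continuous a f : continuous f -> continuous (weighted a f).
Proof.
move=> cf x; apply: cvgM; last exact: cf.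
apply: (@continuous_comp _ _ _ (fun x => a * x) expR); last exact: continuous_expR.
by apply: cvgM; [exact: cvg_cst|exact: cvg_id].
Qed.

Lemma weighted_meas a f : measurable_fun [set: R] f -> measurable_fun [set: R] (weighted a f).
Proof.
move=> mf; apply: measurable_funM => //.
apply: continuous_meas => x.
apply: (@continuous_comp _ _ _ (fun x => a * x) expR); last exact: continuous_expR.
by apply: cvgM; [exact: cvg_cst|exact: cvg_id].
Qed.

Lemma weighted_ae a f g : ae_same f g -> ae_same (weighted a f) (weighted a g).
Proof. by apply: ae_impl => x; rewrite /weighted => ->. Qed.

Lemma expdec_H1w a f df u : 0 < a -> primitive df f -> continuous df ->
  expdec (2 * a) f -> expdec (2 * a) df ->
  measurable_fun [set: R] u -> ae_same u f -> H1 (weighted a u).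
Proof.
move=> a0 d cdf ef edf mu_ uf.
have cf := is_derive_continuous d.
have ew := expdec_weighted a0 ef; have edw := expdec_weighted a0 edf.
have cw := weighted_continuous (a := a) cf; have cdw := weighted_continuous (a := a) cdf.
have mw := weighted_meas a mu_; have aw := weighted_ae a uf.
split; first exact: L2_ae mw aw (expdec_L2 a0 (continuous_meas cw) ew).
exists (fun x => a * weighted a f x + weighted a df x).
  apply: (expdec_L2 a0); last by apply: expdecD => //; exact: expdecZ.
  apply: measurable_funD; last exact: continuous_meas.
  by apply: measurable_funM => //; exact: continuous_meas.
apply: (primitive_weak (weighted_derive a d)) => //.
move=> x; apply: cvgD; last exact: cdw.
by apply: cvgM; [exact: cvg_cst|exact: cw].
Qed.

End transfer.

(** * The kernel of the linearised operator *)

Section linearised.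
Context {R : realType}.
Implicit Types (f g h H Z : R -> R) (b x y c t e C q M T : R) (n j k : nat).
Local Notation mu := (@lebesgue_measure R).
Context (m sigma d a : R) (r v : R -> R).
Context (m_gt1 : 1 < m) (d01 : 0 < d < 1) (sw : solitary_wave m sigma d r v).
Context (a0 : 0 < a) (sa : 2 * expR (4 * a) <= sigma).

Local Notation stiff := (stiffness m sigma r).

Let s0 : 0 < sigma. Proof. by case: sw => -[]. Qed.
Let r_lt1 x : r x < 1. Proof. by case: sw => _ _ _ _ /(_ x)/andP[]. Qed.
Let cstiff := stiffness_cont sw.
Let mstiff : measurable_fun [set: R] stiff := continuous_meas cstiff.
Let stiff_bound x : `|stiff x| <= stiff 0 := stiffness_norm m_gt1 sw x.
Let cdv : continuous (dv v) := dv_cont sw.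
Let a2_ge0 : 0 <= 2 * a. Proof. by rewrite mulr_ge0// ltW. Qed.

Lemma linearised_coefE (h : R -> R) x :
  sigma^-1 * nabla (fun y => ((Phi m)^`(2))%classic (r y) * h y) x =
  nabla (fun y => stiff y * h y) x.
Proof.
rewrite /nabla /stiffness !(derive2_Phi m_gt1)//; ring.
Qed.

(** Both components are averages almost everywhere, which provides continuous
    representatives to which [continuous_solutions] applies. *)
Lemma ker_linop_sub u : ker_linop m a sigma r u -> span1 (dr r, dv v) u.
Proof.
move=> [[[S2 _] [W2 _]] _ [dS [dW [wS wW /= E1 E2]]]].
pose S := u.1; pose W := u.2.
have lS : locint S by apply: loc_locint; case: wS.
have lW : locint W by apply: loc_locint; case: wW.
pose h x := stiff x * S x.
have lh : locint h by exact: (locint_bounded_mul mstiff stiff_bound lS).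
have [mS _] := lS; have [mW _] := lW; have [mh _] := lh.
have h2 : L2 (weighted a h).
  apply: L2_criterion; first exact: weighted_meas.
  have i1 := L1Z (stiff 0 ^+ 2) (L2_sqr S2).
  apply: L1_le i1 _.
    by apply: measurable_funX; exact: weighted_meas.
  move=> x; rewrite (ger0_norm (sqr_ge0 _)); apply: (le_trans _ (ler_norm _)).
  rewrite /weighted /h mulrCA exprMn ler_wpM2r ?sqr_ge0//.
  rewrite -(real_normK (num_real (stiff x))) lerXn2r ?nnegrE//.
  exact: le_trans (normr_ge0 _) (stiff_bound 0).
have eS : {ae mu, forall x, dS x = nabla W x}.
  by apply: ae_impl E1 => x /(_ I)/eqP; rewrite eq_sym subr_eq0 => /eqP.
have eW : {ae mu, forall x, dW x = nabla h x}.
  apply: ae_impl E2 => x /(_ I)/eqP.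
  by rewrite linearised_coefE eq_sym subr_eq0 => /eqP.
have SA : ae_same S (avg W) by exact: (weak_avg a0 wS lW eS S2 W2).
have WA : ae_same W (avg h) by exact: (weak_avg a0 wW lh eW W2 h2).
pose Sb := avg W.
have cSb : continuous Sb by exact: locint_avg_continuous.
have cA : continuous (avg h) by exact: locint_avg_continuous.
have cph : continuous (fun x => stiff x * Sb x).
  by move=> x; apply: cvgM; [exact: cstiff|exact: cSb].
have Ah x : avg h x = avg (fun y => stiff y * Sb y) x.
  apply: avg_ae => //; first exact: continuous_locint.
  by apply: ae_impl SA => y; rewrite /h => ->.
have SbE x : Sb x = avg (avg (fun y => stiff y * Sb y)) x.
  apply: etrans (avg_ae lW (continuous_locint cA) WA x) _.
  by apply: (congr1 (avg ^~ x)); apply/funext => y; exact: Ah.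
have Sbb x : `|Sb x| <= expR (a / 2) * (1 + \int[mu]_y (weighted a W y ^+ 2)) * expR (- a * x).
  apply: le_trans (avg_weighted_bound x a0 lW W2) _.
  rewrite (_ : - a * (x - 2^-1) = a / 2 + - a * x); last by ring.
  by rewrite expRD mulrAC.
have [c Hc] := continuous_solutions m_gt1 d01 sw a0 sa cSb SbE Sbb.
split => //; exists c; split => /=.
  by apply: ae_impl SA => x E _; exact: etrans E (Hc x).
apply: ae_impl WA => x E _; apply: etrans E _; rewrite Ah.
rewrite (dv_avg m_gt1 sw) -RintegralZl//; last first.
  exact: continuous_integrable_cc (stiffness_dr_cont sw).
by apply: eq_Rintegral => y _; rewrite Hc; ring.
Qed.

(** The derivatives of the profiles decay like exp (- 2 a |x|), which compensates
    for the weight. *)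
Lemma span1_sub u : span1 (dr r, dv v) u -> ker_linop m a sigma r u.
Proof.
move=> [/= mS mW [c [E1 E2]]].
have dS : primitive (nabla (dv v)) (dr r).
  have -> : dr r = avg (dv v) by apply/funext => x; exact: (dr_avg sw).
  exact: avg_derive.
have cpd := stiffness_dr_cont sw.
have dW : primitive (nabla (fun y => stiff y * dr r y)) (dv v).
  have -> : dv v = avg (fun y => stiff y * dr r y).
    by apply/funext => x; exact: (dv_avg m_gt1 sw).
  exact: avg_derive.
have cnab f : continuous f -> continuous (nabla f).
  move=> cf x; apply: cvgB.
    apply: (@continuous_comp _ _ _ (fun x => x + 2^-1) f); last exact: cf.
    by apply: cvgD; [exact: cvg_id|exact: cvg_cst].
  apply: (@continuous_comp _ _ _ (fun x => x - 2^-1) f); last exact: cf.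
  by apply: cvgB; [exact: cvg_id|exact: cvg_cst].
have Zd f df : primitive df f -> primitive (fun x => c * df x) (fun x => c * f x).
  by move=> dd x; have := dd x => ?; apply: is_derive_eq.
have Zc f : continuous f -> continuous (fun x => c * f x).
  by move=> cf x; apply: cvgM; [exact: cvg_cst|exact: cf].
have eS := dr_dec m_gt1 sw a0 sa; have eW := dv_dec m_gt1 sw a0 sa.
have epd := stiffness_dr_dec m_gt1 sw a0 sa.
have aS : ae_same u.1 (fun x => c * dr r x) by apply: ae_impl E1 => x; apply.
have aW : ae_same u.2 (fun x => c * dv v x) by apply: ae_impl E2 => x; apply.
have z2 : L2 (weighted a (cst 0 : R -> R)).
  apply: (@expdec_L2 _ a) => //.
    by apply: weighted_meas; exact: measurable_cst.
  by exists 0 => x; rewrite mul0r /weighted mulr0 normr0.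
split.
- split.
    apply: (expdec_H1w a0 (Zd _ _ dS) (Zc _ (cnab _ cdv))) => //; apply: expdecZ => //.
    exact: expdec_nabla.
  apply: (expdec_H1w a0 (Zd _ _ dW) (Zc _ (cnab _ cpd))) => //; apply: expdecZ => //.
  exact: expdec_nabla.
- by split.
exists (fun x => c * nabla (dv v) x), (fun x => c * nabla (fun y => stiff y * dr r y) x).
split => /=.
- exact: primitive_weak (Zd _ _ dS) (Zc _ (cnab _ cdv)) mS aS.
- exact: primitive_weak (Zd _ _ dW) (Zc _ (cnab _ cpd)) mW aW.
- apply: ae_impl (nabla_ae aW) => x -> _.
  by rewrite /nabla; ring.
- have aT : ae_same (fun y => stiff y * u.1 y) (fun y => stiff y * (c * dr r y)).
    by apply: ae_impl aS => x ->.
  apply: ae_impl (nabla_ae aT) => x E _.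
  by rewrite linearised_coefE E /nabla; ring.
Qed.

Lemma ker_eq_span : ker_linop m a sigma r = span1 (dr r, dv v).
Proof. by apply/seteqP; split => u; [exact: ker_linop_sub|exact: span1_sub]. Qed.

End linearised.

Unset Implicit Arguments.

Theorem proposition5 (R : realType) (m a : R) (V Rd : R -> R -> R)
    (sigma : R -> R) (m_gt1 : 1 < m) (a_gt0 : 0 < a)
    (family : solitary_family m V Rd sigma) :
  exists2 d0 : R, 0 < d0 &
    forall d : R, 0 < d < 1 -> d < d0 ->
      ker_linop m a (sigma d) (Rd d) =
      span1 ((Rd d)^`()%classic, (V d)^`()%classic).
Proof.
have [waves energy] := family.
have := cvgey_ge energy (2 * expR (4 * a)) => -[e /= e0 He].
exists e => // d d01 de.
have sw : solitary_wave m (sigma d) d (Rd d) (V d) by exact: waves.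
have sa : 2 * expR (4 * a) <= sigma d.
  rewrite -lee_fin; apply: le_trans (energy_le m_gt1 d01 sw).
  case/andP: d01 => d0 _; apply: He => //=.
  by rewrite sub0r normrN gtr0_norm.
exact: (ker_eq_span m_gt1 d01 sw a_gt0 sa).
Qed.
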